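(* Let $c_0,\delta_0>0$ and let $a\in[0,1]^{\mathbb{Z}}$ be an irreducible, aperiodic sequence. Let $K>0$. There are $C,c\in(0,+\infty)$ and $\lambda_0,n_0\geq 0$ such that the following holds. For any $n\geq n_0$, any independent sequence $X_1,\dots,X_n$ of random variables with laws in $\mathcal{M}_{\delta_0,c_0}^a$, any $\lambda_0\leq\lambda\leq K\sqrt n$, and any $0\leq u,v\leq\lambda$ with $P_u(\bar S_n=v)>0$, $$P_u\bigl(0\leq\min_{i=1,\dots,n}\bar S_i,\ \max_{i=1,\dots,n}\bar S_i\leq\lambda,\ \bar S_n=v\bigr)\geq\frac{C(\min(u,\lambda-u)+1)(\min(v,\lambda-v)+1)}{\lambda^3}\exp\Bigl(-\frac{cn}{\lambda^2}\Bigr).$$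
   Context: Here $u,v$ are real. Write $\bar X_i=X_i-E(X_i)$. Under $P_u$, $\bar S_0=u$ and $\bar S_k=u+\bar X_1+\dots+\bar X_k$. $\mathcal{M}_{\mathbb{Z}}$ is the set of probability measures on $\mathbb{Z}$; $p(i)$ is the mass of $p$ at $i$. A measure $p\in\mathcal{M}_{\mathbb{Z}}$ is called irreducible (resp. aperiodic) if the random walk on $\mathbb{Z}$ with i.i.d. steps of law $p$ is an irreducible (resp. aperiodic) Markov chain. A sequence $a=(a_i)_{i\in\mathbb{Z}}\in[0,1]^{\mathbb{Z}}$ is irreducible and aperiodic if there are an irreducible and aperiodic $p\in\mathcal{M}_{\mathbb{Z}}$ and numbers $b_i>0$, $i\in\mathbb{Z}$, with $a_i=b_ip(i)$ for all $i$. For $\delta,c>0$, $$\mathcal{M}_{\delta,c}^a=\Bigl\{p\in\mathcal{M}_{\mathbb{Z}}:\ \sup_{|t|\leq\delta}\sum_{k\in\mathbb{Z}}p(k)e^{tk}\leq c,\ p(i)\geq a_i\ \forall i\in\mathbb{Z}\Bigr\}.$$ *)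

(* Defs.v *)
From HB Require Import structures.
From mathcomp Require Import all_boot all_order all_algebra.
From mathcomp Require Import all_classical all_reals all_analysis.
Import Order.TTheory GRing.Theory Num.Theory.
Import numFieldNormedType.Exports.

Set Implicit Arguments.
Unset Strict Implicit.
Unset Printing Implicit Defensive.

Local Open Scope classical_set_scope.
Local Open Scope ring_scope.

(* The library makes nat, but not int, a measurable type; as for nat, every
   subset is measurable. *)
HB.instance Definition _ := isPointed.Build int 0.
HB.instance Definition _ := @isMeasurable.Build default_measure_display
  int (@discrete_measurable int) (@discrete_measurable0 int)
  (@discrete_measurableC int) (@discrete_measurableU int).

Section lattice_walks.
Context {R : realType}.
Local Open Scope ereal_scope.
Implicit Types p : probability int R.

Fixpoint walk_prob p (n : nat) (x y : int) : \bar R :=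
  if n is m.+1 then \esum_(z in [set: int]) (p [set (z - x)%R] * walk_prob p m z y)
  else if x == y then 1 else 0.

Definition irreducible_law p : Prop :=
  forall x y : int, exists n : nat, 0 < walk_prob p n x y.

(* The gcd of the set of possible return times is 1: every common divisor
   of these times is 1. *)
Definition aperiodic_law p : Prop :=
  forall (x : int) (d : nat),
    (forall n : nat, (0 < n)%N -> 0 < walk_prob p n x x -> (d %| n)%N) ->
    d = 1%N.

Definition irreducible_aperiodic_seq (a : int -> R) : Prop :=
  exists (p : probability int R) (b : int -> R),
    [/\ irreducible_law p, aperiodic_law p, (forall i, 0 < b i)%R
      & forall i, (a i)%:E = (b i)%:E * p [set i]].

Definition exp_moment p (t : R) : \bar R :=
  \esum_(k in [set: int]) (p [set k] * (expR (t * k%:~R))%:E).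

Definition Mclass (a : int -> R) (delta c : R) : set (probability int R) :=
  [set p | ereal_sup [set exp_moment p t | t in [set t : R | (`|t| <= delta)%R]]
             <= c%:E
         /\ forall i : int, (a i)%:E <= p [set i]].

End lattice_walks.

Section independence.
Context d d' {T : measurableType d} {T' : measurableType d'} {R : realType}.
Local Open Scope ereal_scope.

Definition independent_RVs (I : finType) (P : probability T R)
    (X : I -> {RV P >-> T'}) : Prop :=
  forall (J : {set I}) (A : I -> set T'), (forall i, measurable (A i)) ->
    P [set w | forall i, i \in J -> A i (X i w)] =
    \prod_(i in J) P (X i @^-1` A i).

End independence.

Section centered_walk.
Context d {T : measurableType d} {R : realType} {P : probability T R}.

Definition centered (X : {RV P >-> int}) (w : T) : R :=
  (X w)%:~R - fine 'E_P[fun w' => (X w')%:~R : R].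

Context {n : nat} (X : 'I_n -> {RV P >-> int}) (u : R).

(* The walk started at u: an event under the law P_u is the corresponding
   event for Sbar X u under P.  The steps X_1, ..., X_n are indexed from 0. *)
Definition Sbar (k : nat) (w : T) : R :=
  u + \sum_(i < n | (i < k)%N) centered (X i) w.

(* For n > 0 the value at index n, used as the neutral element, belongs to the
   range 1..n, so these are the min and max over that range. *)
Definition Sbar_min (w : T) : R :=
  \big[Num.min/Sbar n w]_(1 <= k < n.+1) Sbar k w.

Definition Sbar_max (w : T) : R :=
  \big[Num.max/Sbar n w]_(1 <= k < n.+1) Sbar k w.

End centered_walk.

(* Main.v *)
Require Import Defs.
From HB Require Import structures.
From mathcomp Require Import all_boot all_order all_algebra.
From mathcomp Require Import all_classical all_reals all_analysis.
From mathcomp Require Import lra ring zify.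
Import Order.TTheory GRing.Theory Num.Theory.
Import numFieldNormedType.Exports.

Set Implicit Arguments.
Unset Strict Implicit.
Unset Printing Implicit Defensive.

Local Open Scope classical_set_scope.
Local Open Scope ring_scope.

(** Centre the interval at 0, let the walk sit at x in it and put
    q (x) = (rho - x ^ 2) / lambda ^ 2.  For t >= 0 let Phi t = t + A t ^ 2,
    and Phi t = 0 for t < 0.  Near the ends of the interval q is small and has
    slope of order 1 / lambda, so a step with variance between s0 and sg2
    increases the mean of A q ^ 2 by about A s0 / lambda ^ 2, while it decreases
    the mean of q by at most (kap + sg2) / lambda ^ 2, even when rho itself drops
    by kap.
    With A large the first effect wins; away from the ends the loss is at most
    a multiple of Phi q / lambda ^ 2.  So one step multiplies Phi q by at least
    1 - c / lambda ^ 2 in mean ([funnel_step]), uniformly over all steps whose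
    variance is at most sg2 and at least s0 within bounded deviations.  Iterating
    over n steps, with rho shrinking at the end, gives a lower bound of order
    Phi (q (u)) exp (- c n / lambda ^ 2) for the probability to stay in the
    interval and to end in its middle part.  Here Phi (q (u)) is of the order of
    the distance of u to the ends divided by lambda, and the kink of Phi at 0
    yields the extra + 1 at the first step ([first_step]).

    The time n is cut into three pieces.  The first one brings the walk from u
    to the middle part, the last one, read backwards in time, brings it from v
    to the middle part ([forward_landing_first], [backward_landing_first]).  The
    piece between them lasts of the order of th lambda ^ 2 steps, th small, and
    has to join two given points x and z of the middle part with probability at
    least of order 1 / lambda ([middle_lower]).  The three estimates multiply to
    the stated product, by a sum over x and z ([bridge_lower]).

    For the middle piece, irreducibility and aperiodicity give words of equal
    length N over the support of a whose sums differ by 1 ([word_diff_unit]).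
    A block of N steps therefore contains, with a weight bounded below, a fair
    coin deciding between b and b + 1.  Collecting these coins, the law of the
    sum of M blocks is a mixture of translates of binomial laws, and the
    estimates of binomial coefficients of order 1 / sqrt M carry over to upper
    and lower local bounds for the free walk ([local_upper], [local_lower]).
    Paths that leave the interval during the middle piece are negligible: by a
    Chebyshev bound they have probability of order th, and the local upper bound
    on the other half of the piece supplies the factor 1 / lambda.

    All these estimates are about the operators that the steps induce on
    functions on the integers.  Killed walks see finitely many points only, so
    reversal of time is a duality of finite sums ([run_dual]), and the passage
    to random variables only uses finite additivity ([run_le_prob]). *)

(** * Expectations of functions of at most quadratic growth *)

Section expectation.
Context {R : realType}.
Implicit Types (f g : int -> R).

(** A finite second moment makes every function of at most quadratic growth
    integrable, so the laws carry it along. *)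
Record law := Law {
  law_prob :> probability int R;
  law_sq : law_prob.-integrable setT (fun k => ((k%:~R : R) ^+ 2)%:E) }.

Implicit Type p : law.

(** Every function integrated below is bounded or quadratic, so this one
    condition serves as integrability criterion for all laws. *)
Definition quad_growth f := exists C, forall k, `|f k| <= C * (1 + k%:~R ^+ 2).

Definition E p f : R := Rintegral p setT f.

Lemma quad_growth_integrable p f :
  quad_growth f -> p.-integrable setT (EFin \o f).
Proof.
move=> [C Cf].
apply: (@le_integrable _ _ _ p setT measurableT _
  (fun k => (C%:E * (1 + ((k%:~R : R) ^+ 2)%:E))%E)) => //.
- move=> k _ /=; rewrite lee_fin (le_trans (Cf k))// ler_norm//.
- apply: integrableZl => //; apply: integrableD => //; last exact: law_sq.
  exact: finite_measure_integrable_cst.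
Qed.

Lemma quad_growth_bounded f C : (forall k, `|f k| <= C) -> quad_growth f.
Proof.
move=> Cf; exists C => k; apply: (le_trans (Cf k)).
have C0 : 0 <= C by apply: le_trans (Cf 0).
by rewrite ler_peMr// lerDl sqr_ge0.
Qed.

Lemma quad_growth_cst c : quad_growth (fun=> c).
Proof. exact: (@quad_growth_bounded _ `|c|). Qed.

Lemma quad_growthD f g :
  quad_growth f -> quad_growth g -> quad_growth (fun k => f k + g k).
Proof.
move=> [C Cf] [D Dg]; exists (C + D) => k.
by rewrite mulrDl (le_trans (ler_normD _ _))// lerD.
Qed.

Lemma quad_growthZ c f : quad_growth f -> quad_growth (fun k => c * f k).
Proof.
move=> [C Cf]; exists (`|c| * C) => k.
by rewrite normrM -mulrA ler_wpM2l.
Qed.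

Lemma quad_growth_le f g :
  (forall k, `|f k| <= `|g k|) -> quad_growth g -> quad_growth f.
Proof. by move=> fg [C Cg]; exists C => k; exact: le_trans (Cg k). Qed.

Lemma quad_growth_poly (c b a : R) :
  quad_growth (fun k => c + b * k%:~R + a * k%:~R ^+ 2).
Proof.
exists (`|c| + `|b| + `|a|) => k; set x : R := k%:~R.
have x2 : `|x| <= 1 + x ^+ 2 by rewrite -(real_normK (num_real x)); nra.
have h1 := ler_normD (c + b * x) (a * x ^+ 2).
have h2 := ler_normD c (b * x).
have h3 : `|b * x| <= `|b| * (1 + x ^+ 2) by rewrite normrM ler_wpM2l.
have h4 : `|a * x ^+ 2| = `|a| * x ^+ 2 by rewrite normrM (ger0_norm (sqr_ge0 _)).
have := normr_ge0 c; have := normr_ge0 a; have := sqr_ge0 x.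
nra.
Qed.

Lemma quad_growth_reindex (h : int -> int) f (s : int) :
  (forall k, h k = s + k \/ h k = s - k) ->
  quad_growth f -> quad_growth (fun k => f (h k)).
Proof.
move=> hE [C Cf].
have C0 : 0 <= C by have := le_trans (normr_ge0 _) (Cf 0); rewrite expr0n addr0 mulr1.
exists (C * (2 + 2 * s%:~R ^+ 2)) => k.
apply: (le_trans (Cf _)); rewrite -mulrA ler_wpM2l//.
set x : R := k%:~R; set y : R := s%:~R.
have : ((h k)%:~R : R) = y + x \/ ((h k)%:~R : R) = y - x.
  by case: (hE k) => ->; rewrite ?intrD ?mulrNz; [left|right].
have := sqr_ge0 (x * y); have := sqr_ge0 (x - y); have := sqr_ge0 (x + y).
by move=> h1 h2 h3 [->|->]; nra.
Qed.

Lemma E_cst p c : E p (fun=> c) = c.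
Proof. rewrite /E (Rintegral_cst p measurableT c).
have p1 := @probability_setT _ _ _ (law_prob p).
by rewrite [X in _ * X](congr1 fine p1) mulr1. Qed.

Lemma ED p f g : quad_growth f -> quad_growth g ->
  E p (fun k => f k + g k) = E p f + E p g.
Proof. by move=> qf qg; rewrite /E RintegralD//; exact: quad_growth_integrable. Qed.

Lemma EZ p c f : quad_growth f -> E p (fun k => c * f k) = c * E p f.
Proof. by move=> qf; rewrite /E RintegralZl//; exact: quad_growth_integrable. Qed.

Lemma E_le p f g : quad_growth f -> quad_growth g -> (forall k, f k <= g k) ->
  E p f <= E p g.
Proof. by move=> qf qg fg; apply: le_Rintegral => //; exact: quad_growth_integrable. Qed.

Lemma E_ge0 p f : (forall k, 0 <= f k) -> 0 <= E p f.
Proof. by move=> f0; apply: Rintegral_ge0. Qed.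

Lemma eq_E p f g : f =1 g -> E p f = E p g.
Proof. by move=> /funext ->. Qed.

Lemma quad_growth_sum (I : Type) (r : seq I) (F : I -> int -> R) :
  (forall i, quad_growth (F i)) -> quad_growth (fun k => \sum_(i <- r) F i k).
Proof.
move=> qF; elim: r => [|i r IH].
  by under eq_fun do rewrite big_nil; exact: quad_growth_cst.
by under eq_fun do rewrite big_cons; exact: quad_growthD.
Qed.

Lemma E_sum p (I : Type) (r : seq I) (F : I -> int -> R) :
  (forall i, quad_growth (F i)) ->
  E p (fun k => \sum_(i <- r) F i k) = \sum_(i <- r) E p (F i).
Proof.
move=> qF; elim: r => [|i r IH].
  by under eq_E do rewrite big_nil; rewrite E_cst big_nil.
under eq_E do rewrite big_cons; rewrite ED//; last exact: quad_growth_sum.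
by rewrite big_cons IH.
Qed.

Lemma E_bounds p f c d : (forall k, c <= f k <= d) -> c <= E p f <= d.
Proof.
move=> h.
have qf : quad_growth f.
  apply: (@quad_growth_bounded _ (`|c| + `|d|)) => k; have /andP[h1 h2] := h k.
  rewrite ler_norml; apply/andP; split.
    have := ler_norm (- c); rewrite normrN; have := normr_ge0 d; lra.
  by have := ler_norm d; have := normr_ge0 c; lra.
rewrite -{1}(E_cst p c) -[X in _ <= _ <= X](E_cst p d).
by apply/andP; split; apply: E_le => //; try exact: quad_growth_cst;
  move=> k; case/andP: (h k).
Qed.

Definition mass p (k : int) : R := fine (p [set k]).

Lemma massE p k : p [set k] = (mass p k)%:E.
Proof. by rewrite /mass fineK// fin_num_measure. Qed.

Lemma E_dirac p (j : int) : E p (fun k => (k == j)%:R) = mass p j.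
Proof.
rewrite /E /Rintegral /mass; congr fine.
transitivity (\int[p]_(x in setT) (\1_[set j] x)%:E)%E.
  apply: eq_integral => k _; rewrite indicE.
  suff -> : (k \in [set j]) = (k == j) by [].
  by apply/idP/eqP => [/set_mem|->]; [|exact: mem_set].
by rewrite integral_indic// setIT.
Qed.

Lemma E_finite p f (s : int) (F : seq int) : uniq F ->
  (forall k, f k != 0 -> s + k \in F) ->
  E p f = \sum_(z <- F) mass p (z - s) * f (z - s).
Proof.
move=> uF Ff.
have -> : f = fun k => \sum_(z <- F) f (z - s) * (k == z - s)%:R.
  apply/funext => k; have [kF|kF] := boolP (s + k \in F).
    have e : s + k - s = k by rewrite addrC addKr.
    rewrite (bigD1_seq (s + k))//= e eqxx mulr1.
    rewrite big1 ?addr0// => z zk.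
    case: eqP => [kE|]; last by rewrite mulr0.
    by move: zk; rewrite kE addrC subrK eqxx.
  have -> : f k = 0 by apply: contraNeq kF; exact: Ff.
  rewrite big_seq big1// => z zF; case: eqP => [kE|]; last by rewrite mulr0.
  by move: kF; rewrite kE addrC subrK zF.
rewrite E_sum; last first.
  move=> z; apply: quad_growthZ; apply: (@quad_growth_bounded _ 1) => k.
  by case: eqP; rewrite ?normr1 ?normr0.
rewrite [LHS]big_seq [RHS]big_seq; apply: eq_bigr => z zF.
rewrite EZ; last first.
  apply: (@quad_growth_bounded _ 1) => k.
  by case: eqP; rewrite ?normr1 ?normr0.
rewrite E_dirac mulrC; congr (_ * _).
rewrite (bigD1_seq z)//= eqxx mulr1 big1 ?addr0// => y yz.
case: eqP => [/addIr zy|]; last by rewrite mulr0.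
by rewrite zy eqxx in yz.
Qed.

Lemma E_ge_mass p f (r : seq int) : uniq r -> quad_growth f ->
  (forall k, 0 <= f k) -> \sum_(j <- r) mass p j * f j <= E p f.
Proof.
move=> ur qf f0.
set g := fun k => if k \in r then f k else 0.
have -> : \sum_(j <- r) mass p j * f j = E p g.
  rewrite (@E_finite p g 0 r)//; last first.
    by move=> k; rewrite /g add0r; case: ifP => // _; rewrite eqxx.
  rewrite [LHS]big_seq [RHS]big_seq; apply: eq_bigr => z zr.
  by rewrite /g subr0 zr.
apply: E_le => //; last by move=> k; rewrite /g; case: ifP.
apply: quad_growth_le qf => k; rewrite /g; case: ifP => // _.
by rewrite normr0.
Qed.

Lemma quad_growth01 f : (forall k, 0 <= f k <= 1) -> quad_growth f.
Proof.
move=> h; apply: (@quad_growth_bounded _ 1) => k.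
by case/andP: (h k) => h1 h2; rewrite ger0_norm.
Qed.

Definition lmean p : R := E p (fun k => k%:~R).
Definition lvar p : R := E p (fun k => (k%:~R - lmean p) ^+ 2).

Lemma E_quad p (a b c : R) :
  E p (fun k => c + b * k%:~R + a * k%:~R ^+ 2)
    = c + b * lmean p + a * E p (fun k => k%:~R ^+ 2).
Proof.
have q1 : quad_growth (fun k => k%:~R : R).
  have := quad_growth_poly 0 1 0; congr quad_growth; apply/funext => k.
  by rewrite add0r mul1r mul0r addr0.
have q2 : quad_growth (fun k => k%:~R ^+ 2 : R).
  have := quad_growth_poly 0 0 1; congr quad_growth; apply/funext => k.
  by rewrite mul0r !add0r mul1r.
rewrite (ED p (f := fun k => c + b * k%:~R)) ?EZ//; last 2 first.
- by apply: quad_growthD; [exact: quad_growth_cst|exact: quad_growthZ].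
- exact: quad_growthZ.
rewrite ED ?E_cst ?EZ//; [exact: quad_growth_cst|exact: quad_growthZ].
Qed.

Lemma lvar_quad p (d : R) :
  E p (fun k => (d - k%:~R) ^+ 2) = (d - lmean p) ^+ 2 + lvar p.
Proof.
have e x : E p (fun k => (x - k%:~R) ^+ 2) =
    x ^+ 2 + (- 2 * x) * lmean p + 1 * E p (fun k => k%:~R ^+ 2).
  by rewrite -E_quad; apply: eq_E => k; ring.
rewrite e /lvar.
rewrite (eq_E p (f := fun k => (k%:~R - lmean p) ^+ 2)
  (g := fun k => (lmean p - k%:~R) ^+ 2)); last by move=> k; ring.
rewrite e; ring.
Qed.

Lemma lvar_ge0 p : 0 <= lvar p.
Proof. by apply: E_ge0 => k; exact: sqr_ge0. Qed.

Lemma mean_var_sq p : lmean p ^+ 2 + lvar p = E p (fun k => k%:~R ^+ 2).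
Proof.
have := lvar_quad p 0; rewrite sub0r sqrrN => <-.
by apply: eq_E => k; rewrite sub0r sqrrN.
Qed.

End expectation.
Arguments law : clear implicits.

(** * Killed walks and their transposes *)

Section walks.
Context {R : realType}.
Implicit Types (f g : int -> R) (q : law R) (w : nat -> int -> bool).

(** The flag e selects the transition operator of a step (false) or its
    transpose (true). *)
Definition shift (e : bool) q g (s : int) : R :=
  E q (fun k => g (if e then s - k else s + k)).

Lemma quad_growth_comp e g (s : int) : quad_growth g ->
  quad_growth (fun k => g (if e then s - k else s + k)).
Proof.
by apply: quad_growth_reindex => k; case: e; [right|left].
Qed.

Lemma quad_growth_shift e q g : quad_growth g -> quad_growth (shift e q g).
Proof.
move=> qg; have qq s := quad_growth_comp e s qg; case: qg => C Cg.
have C0 : 0 <= C by have := le_trans (normr_ge0 _) (Cg 0); rewrite expr0n addr0 mulr1.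
set m2 := E q (fun k => k%:~R ^+ 2).
have m0 : 0 <= m2 by apply: E_ge0 => k; exact: sqr_ge0.
exists (C * (2 + 2 * m2)) => s.
have qb : quad_growth (fun k => C * (1 + 2 * s%:~R ^+ 2) + 0 * k%:~R
    + (C * 2) * k%:~R ^+ 2) by exact: quad_growth_poly.
have le1 : forall k, `|g (if e then s - k else s + k)| <=
    C * (1 + 2 * s%:~R ^+ 2) + 0 * k%:~R + (C * 2) * k%:~R ^+ 2.
  move=> k; apply: (le_trans (Cg _)).
  rewrite mul0r addr0 -!mulrA -mulrDr ler_wpM2l//.
  have h1 := sqr_ge0 ((s%:~R : R) - k%:~R).
  have h2 := sqr_ge0 ((s%:~R : R) + k%:~R).
  by case: e {qq}; rewrite intrD ?mulrNz; nra.
have : `|shift e q g s| <= C * (1 + 2 * s%:~R ^+ 2) + 0 * lmean q + C * 2 * m2.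
  rewrite -E_quad ler_norml; apply/andP; split.
    rewrite lerNl -mulN1r -EZ//; apply: E_le => //; first exact: quad_growthZ.
    move=> k; apply: le_trans (le1 k).
    by rewrite mulN1r -normrN ler_norm.
  by apply: E_le => // k; apply: le_trans (le1 k); exact: ler_norm.
move/le_trans; apply.
rewrite mul0r addr0 -!mulrA -mulrDr ler_wpM2l//.
have := sqr_ge0 (s%:~R : R); nra.
Qed.

Lemma shiftD e q f g : quad_growth f -> quad_growth g ->
  shift e q (fun s => f s + g s) = (fun s => shift e q f s + shift e q g s).
Proof.
by move=> qf qg; apply/funext => s; rewrite /shift ED//; exact: quad_growth_comp.
Qed.

Lemma shiftZ e q c f : quad_growth f ->
  shift e q (fun s => c * f s) = (fun s => c * shift e q f s).
Proof.
by move=> qf; apply/funext => s; rewrite /shift EZ//; exact: quad_growth_comp.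
Qed.

Lemma shift_cst e q c : shift e q (fun=> c) = (fun=> c).
Proof. by apply/funext => s; rewrite /shift E_cst. Qed.

Lemma shift_le e q f g : quad_growth f -> quad_growth g -> (forall s, f s <= g s) ->
  forall s, shift e q f s <= shift e q g s.
Proof. by move=> qf qg fg s; apply: E_le => [| |k//]; exact: quad_growth_comp. Qed.

Lemma shift_ge0 e q f : (forall s, 0 <= f s) -> forall s, 0 <= shift e q f s.
Proof. by move=> f0 s; exact: E_ge0. Qed.

Lemma shift_sum e q (I : Type) (r : seq I) (F : I -> int -> R) :
  (forall i, quad_growth (F i)) ->
  shift e q (fun s => \sum_(i <- r) F i s) = (fun s => \sum_(i <- r) shift e q (F i) s).
Proof.
by move=> qF; apply/funext => s; rewrite /shift E_sum// => i; exact: quad_growth_comp.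
Qed.

Lemma quad_growth_kill (b : int -> bool) f :
  quad_growth f -> quad_growth (fun s => (b s)%:R * f s).
Proof.
apply: quad_growth_le => s; case: (b s); first by rewrite mul1r.
by rewrite mul0r normr0.
Qed.

Variable p : nat -> law R.

(** run w i n f s is the mean of f at time i + n for the walk at s at time i,
    killed when it is outside the window w j at a later time j.  The transpose
    corun acts on functions at time i and gives functions at time i + n: it is
    the same walk run backwards. *)
Fixpoint run w (i n : nat) f : int -> R :=
  if n is m.+1 then
    shift false (p i) (fun s => (w i.+1 s)%:R * run w i.+1 m f s)
  else f.

Fixpoint corun w (i n : nat) f : int -> R :=
  if n is m.+1 then
    fun s => (w (i + n)%N s)%:R * shift true (p (i + m)%N) (corun w i m f) s
  else f.

Definition free : nat -> int -> bool := fun _ _ => true.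

Lemma run_freeS i n f : run free i n.+1 f = shift false (p i) (run free i.+1 n f).
Proof. by rewrite /=; congr shift; apply/funext => s; rewrite mul1r. Qed.

Lemma quad_growth_run w i n f : quad_growth f -> quad_growth (run w i n f).
Proof.
move=> qf; elim: n i => [//|n IH] i /=.
by apply: quad_growth_shift; exact: quad_growth_kill.
Qed.

Lemma quad_growth_corun w i n f : quad_growth f -> quad_growth (corun w i n f).
Proof.
move=> qf; elim: n => [//|n IH] /=.
by apply: quad_growth_kill; exact: quad_growth_shift.
Qed.

Lemma run_cat w i m n f : run w i (m + n) f = run w i m (run w (i + m) n f).
Proof.
elim: m i => [|m IH] i; first by rewrite addn0.
by rewrite addSn /= IH addSnnS.
Qed.

Lemma run_last w i n f :
  run w i n.+1 f =
  run w i n (shift false (p (i + n)%N) (fun s => (w (i + n).+1 s)%:R * f s)).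
Proof. by rewrite -addn1 run_cat. Qed.

Lemma run_le w i n f g : quad_growth f -> quad_growth g ->
  (forall s, f s <= g s) -> forall s, run w i n f s <= run w i n g s.
Proof.
move=> qf qg fg; elim: n i => [//|n IH] i /= s.
apply: shift_le => [| |z].
- by apply: quad_growth_kill; exact: quad_growth_run.
- by apply: quad_growth_kill; exact: quad_growth_run.
- by apply: ler_wpM2l => //; exact: ler0n.
Qed.

Lemma run_ge0 w i n f : (forall s, 0 <= f s) -> forall s, 0 <= run w i n f s.
Proof.
move=> f0; elim: n i => [//|n IH] i /= s.
by apply: shift_ge0 => z; rewrite mulr_ge0.
Qed.

Lemma run_cst_free i n c : run free i n (fun=> c) = (fun=> c).
Proof.
by elim: n i => [//|n IH] i; rewrite run_freeS IH shift_cst.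
Qed.

Lemma run_le_free w i n f : quad_growth f -> (forall s, 0 <= f s) ->
  forall s, run w i n f s <= run free i n f s.
Proof.
move=> qf f0; elim: n i => [//|n IH] i s; rewrite run_freeS.
apply: shift_le => [| |z].
- by apply: quad_growth_kill; exact: quad_growth_run.
- exact: quad_growth_run.
- apply: le_trans (IH i.+1 z).
  by rewrite ler_piMl ?run_ge0// lern1 leq_b1.
Qed.

Lemma runZ w i n c f : quad_growth f ->
  run w i n (fun s => c * f s) = (fun s => c * run w i n f s).
Proof.
move=> qf; elim: n i => [//|n IH] i /=; rewrite IH.
under eq_fun do rewrite mulrCA.
by rewrite shiftZ//; apply: quad_growth_kill; exact: quad_growth_run.
Qed.

Lemma runD w i n f g : quad_growth f -> quad_growth g ->
  run w i n (fun s => f s + g s) = (fun s => run w i n f s + run w i n g s).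
Proof.
move=> qf qg; elim: n i => [//|n IH] i /=; rewrite IH.
under eq_fun do rewrite mulrDr.
by rewrite shiftD//; apply: quad_growth_kill; exact: quad_growth_run.
Qed.

Lemma run_sum w i n (I : Type) (r : seq I) (F : I -> int -> R) :
  (forall j, quad_growth (F j)) ->
  run w i n (fun s => \sum_(j <- r) F j s) = (fun s => \sum_(j <- r) run w i n (F j) s).
Proof.
move=> qF; elim: n i => [//|n IH] i /=; rewrite IH.
under eq_fun do rewrite mulr_sumr.
by rewrite shift_sum// => j; apply: quad_growth_kill; exact: quad_growth_run.
Qed.

Definition delta (y : int) : int -> R := fun s => (s == y)%:R.

Lemma delta01 y s : 0 <= delta y s <= 1.
Proof. by rewrite /delta; case: eqP; rewrite lexx ler01. Qed.

Lemma quad_growth_delta y : quad_growth (delta y).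
Proof. by apply: quad_growth01; exact: delta01. Qed.

Lemma sum_delta (F : seq int) f s : uniq F ->
  \sum_(z <- F) f z * delta z s = (s \in F)%:R * f s.
Proof.
move=> uF; have [sF|sF] := boolP (s \in F).
  rewrite (bigD1_seq s)//= /delta eqxx mulr1 big1 ?addr0 ?mul1r// => z zs.
  by rewrite eq_sym (negPf zs) mulr0.
rewrite mul0r big_seq big1// => z zF; rewrite /delta; case: eqP => [sz|].
  by rewrite sz zF in sF.
by rewrite mulr0.
Qed.

Lemma run_ge_window w i n (F : seq int) f s : uniq F ->
  quad_growth f -> (forall z, 0 <= f z) ->
  \sum_(z <- F) f z * run w i n (delta z) s <= run w i n f s.
Proof.
move=> uF qf f0.
have -> : \sum_(z <- F) f z * run w i n (delta z) s =
    run w i n (fun s => \sum_(z <- F) f z * delta z s) s.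
  rewrite run_sum; last by move=> j; apply: quad_growthZ; exact: quad_growth_delta.
  apply: eq_bigr => z _; rewrite runZ//; exact: quad_growth_delta.
have e : (fun s => \sum_(z <- F) f z * delta z s) = fun s => (s \in F)%:R * f s.
  by apply/funext => z; exact: sum_delta.
rewrite e; apply: run_le => //; first exact: (quad_growth_kill (fun s => s \in F) qf).
by move=> z; rewrite ler_piMl// lern1 leq_b1.
Qed.

Lemma run_window w i n (F : seq int) f s : uniq F ->
  (forall z, w (i + n.+1)%N z -> z \in F) -> quad_growth f ->
  run w i n.+1 f s = \sum_(z <- F) f z * run w i n.+1 (delta z) s.
Proof.
move=> uF wF qf.
have -> : \sum_(z <- F) f z * run w i n.+1 (delta z) s =
    run w i n.+1 (fun s => \sum_(z <- F) f z * delta z s) s.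
  rewrite run_sum; last by move=> j; apply: quad_growthZ; exact: quad_growth_delta.
  apply: eq_bigr => z _; rewrite runZ//; exact: quad_growth_delta.
rewrite !run_last; congr (run _ _ _ (shift _ _ _) _); apply/funext => z.
rewrite sum_delta//; have [wz|] := boolP (w (i + n).+1 z); last by rewrite !mul0r.
by rewrite wF ?mul1r// addnS.
Qed.

Lemma shift_finite q g (F : seq int) s : uniq F -> (forall z, g z != 0 -> z \in F) ->
  shift false q g s = \sum_(z <- F) mass q (z - s) * g z.
Proof.
move=> uF gF; rewrite /shift (@E_finite _ q _ s F)//; last by move=> k; exact: gF.
by apply: eq_bigr => z _; rewrite [s + (z - s)]addrC subrK.
Qed.

Lemma coshift_finite q g (F : seq int) s : uniq F -> (forall z, g z != 0 -> z \in F) ->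
  shift true q g s = \sum_(z <- F) mass q (s - z) * g z.
Proof.
move=> uF gF; rewrite /shift (@E_finite _ q _ 0 [seq s - z | z <- F])//.
- rewrite big_map; apply: eq_bigr => z _.
  by rewrite subr0 opprB [s + (z - s)]addrC subrK.
- by rewrite map_inj_uniq// => x y /addrI /oppr_inj.
- move=> k /gF kF; rewrite add0r; apply/mapP; exists (s - k) => //.
  by rewrite opprB [s + (k - s)]addrC subrK.
Qed.

Lemma sum_shift_dual q f g (F : seq int) : uniq F ->
  (forall z, f z != 0 -> z \in F) -> (forall z, g z != 0 -> z \in F) ->
  \sum_(z <- F) f z * shift false q g z = \sum_(z <- F) shift true q f z * g z.
Proof.
move=> uF fF gF.
under eq_bigr do rewrite (shift_finite _ _ uF gF) mulr_sumr.
under [RHS]eq_bigr do rewrite (coshift_finite _ _ uF fF) mulr_suml.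
rewrite exchange_big /=; apply: eq_bigr => y _; apply: eq_bigr => z _; ring.
Qed.

Lemma corun_support w i n f (F : seq int) : (forall z, f z != 0 -> z \in F) ->
  (forall j z, (i < j <= i + n)%N -> w j z -> z \in F) ->
  forall z, corun w i n f z != 0 -> z \in F.
Proof.
move=> fF; case: n => [//|n] wF z /=.
have [wz _|] := boolP (w (i + n.+1)%N z).
  by apply: wF wz; rewrite leqnn andbT addnS ltnS leq_addr.
by rewrite mul0r eqxx.
Qed.

(** Reversal of time: the sums are finite because F contains the support of f
    and the windows, so transposition needs no convergence argument. *)
Lemma run_dual w i n f g (F : seq int) : uniq F ->
  (forall j z, (i < j <= i + n)%N -> w j z -> z \in F) ->
  (forall z, f z != 0 -> z \in F) ->
  \sum_(z <- F) f z * run w i n g z = \sum_(z <- F) corun w i n f z * g z.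
Proof.
move=> uF wF fF; elim: n g wF => [//|n IH] g wF.
have wF' j z : (i < j <= i + n)%N -> w j z -> z \in F.
  by move=> /andP[ij jn]; apply: wF; rewrite ij addnS leqW.
rewrite run_last IH// sum_shift_dual//; first last.
- move=> z; have [wz _|] := boolP (w (i + n).+1 z).
    by apply: wF wz; rewrite addnS leqnn andbT ltnS leq_addr.
  by rewrite mul0r eqxx.
- exact: corun_support.
by apply: eq_bigr => z _ /=; rewrite addnS; ring.
Qed.

Lemma corun_delta w i n f (F : seq int) t : uniq F ->
  (forall j z, (i < j <= i + n)%N -> w j z -> z \in F) ->
  (forall z, f z != 0 -> z \in F) -> t \in F ->
  \sum_(z <- F) f z * run w i n (delta t) z = corun w i n f t.
Proof.
move=> uF wF fF tF; rewrite (run_dual _ uF wF fF).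
have := @sum_delta F (corun w i n f) t uF; rewrite tF mul1r => <-.
by apply: eq_bigr => z _; rewrite /delta eq_sym.
Qed.

(** The steps are translation invariant, so the sum over starting points of the
    probability to be at t is at most 1, as is the sum over final points. *)
Lemma sum_free_delta_le1 i n (F : seq int) t : uniq F ->
  \sum_(z <- F) run free i n (delta t) z <= 1.
Proof.
elim: n i F => [|n IH] i F uF.
  rewrite /=; under eq_bigr do rewrite /delta.
  have [tF|tF] := boolP (t \in F).
    rewrite (bigD1_seq t)//= eqxx big1 ?addr0// => z zt.
    by rewrite (negPf zt).
  rewrite big_seq big1// => z zF; case: eqP => // zt.
  by rewrite -zt zF in tF.
rewrite run_freeS; set h := run free i.+1 n (delta t).
have qh : quad_growth h by apply: quad_growth_run; exact: quad_growth_delta.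
rewrite -E_sum; last by move=> z; exact: (quad_growth_comp false).
suff h01 k : 0 <= \sum_(z <- F) h (z + k) <= 1 by have /andP[_] := E_bounds (p i) h01.
apply/andP; split.
  apply: sumr_ge0 => z _; apply: run_ge0 => y.
  by case/andP: (delta01 t y).
have := IH i.+1 [seq z + k | z <- F]; rewrite map_inj_uniq; last by move=> x y /addIr.
by move=> /(_ uF); rewrite big_map.
Qed.

Definition mean_sum i n : R := \sum_(i <= j < i + n) lmean (p j).
Definition var_sum i n : R := \sum_(i <= j < i + n) lvar (p j).

Lemma mean_sumS i n : mean_sum i n.+1 = lmean (p i) + mean_sum i.+1 n.
Proof. by rewrite /mean_sum big_ltn ?addnS ?ltnS ?leq_addr// addSn. Qed.

Lemma var_sumS i n : var_sum i n.+1 = lvar (p i) + var_sum i.+1 n.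
Proof. by rewrite /var_sum big_ltn ?addnS ?ltnS ?leq_addr// addSn. Qed.

Lemma quad_growth_sq (d : R) : quad_growth (fun s => (d - s%:~R) ^+ 2).
Proof.
have := quad_growth_poly (d ^+ 2) (- 2 * d) 1; congr quad_growth.
by apply/funext => s; ring.
Qed.

Lemma run_free_sq i n (d : R) :
  run free i n (fun s => (d - s%:~R) ^+ 2) =
  fun s => (d - s%:~R - mean_sum i n) ^+ 2 + var_sum i n.
Proof.
elim: n i => [|n IH] i.
  by apply/funext => s; rewrite /= /mean_sum /var_sum addn0 !big_geq// subr0 addr0.
apply/funext => s; rewrite run_freeS IH mean_sumS var_sumS /shift.
transitivity (E (p i) (fun k => (d - s%:~R - mean_sum i.+1 n - k%:~R) ^+ 2 + var_sum i.+1 n)).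
  by apply: eq_E => k; rewrite intrD; ring.
rewrite ED ?E_cst ?lvar_quad; [ring|exact: quad_growth_sq|exact: quad_growth_cst].
Qed.

End walks.
Arguments free : clear implicits.

(** * A profile that one step hardly decreases *)

Section funnel.
Context {R : realType}.
Implicit Types (q : law R) (e : bool).

(** The sign makes the one-step estimates available for the walk and for its
    reversal. *)
Definition centred e q (k : int) : R := if e then lmean q - k%:~R else k%:~R - lmean q.

Definition near_mean (B : R) q (k : int) : R := (`|k%:~R - lmean q| <= B)%R%:R.

Lemma centred_sq e q k : centred e q k ^+ 2 = (k%:~R - lmean q) ^+ 2.
Proof. by rewrite /centred; case: e => //; ring. Qed.

Lemma near_meanP B e q k : near_mean B q k = (`|centred e q k| <= B)%R%:R.
Proof. by rewrite /near_mean /centred; case: e => //; rewrite distrC. Qed.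

Lemma quad_growth_centred e q : quad_growth (centred e q).
Proof.
have := quad_growth_poly (if e then lmean q else - lmean q) (if e then -1 else 1) 0.
by congr quad_growth; apply/funext => k; rewrite /centred; case: e; ring.
Qed.

Lemma quad_growth_centred_sq q : quad_growth (fun k : int => (k%:~R - lmean q) ^+ 2 : R).
Proof.
have := quad_growth_poly (lmean q ^+ 2) (- 2 * lmean q) 1; congr quad_growth.
by apply/funext => k; ring.
Qed.

Lemma quad_growth_near B q :
  quad_growth (fun k => (k%:~R - lmean q) ^+ 2 * near_mean B q k).
Proof.
apply: quad_growth_le (quad_growth_centred_sq q) => k; rewrite /near_mean.
by case: (_ <= B); rewrite ?mulr1// mulr0 normr0.
Qed.

Lemma E_centred e q : E q (centred e q) = 0.
Proof.
rewrite (eq_E q (g := fun k => (if e then lmean q else - lmean q)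
  + (if e then -1 else 1) * k%:~R + 0 * k%:~R ^+ 2)); last first.
  by move=> k; rewrite /centred; case: e; ring.
by rewrite E_quad; case: e; ring.
Qed.

(** The part of the variance due to values within B of the mean.  Bounded
    deviations are needed where the profile is compared with its quadratic
    expansion beyond its kink. *)
Definition trunc_var B q := E q (fun k => (k%:~R - lmean q) ^+ 2 * near_mean B q k).

Lemma E_centred_quad B e q (c b a a' : R) :
  E q (fun k => c + b * centred e q k + a * centred e q k ^+ 2
        + a' * (centred e q k ^+ 2 * near_mean B q k))
    = c + a * lvar q + a' * trunc_var B q.
Proof.
under eq_E do rewrite !centred_sq.
have q1 := quad_growth_centred e q; have q2 := quad_growth_centred_sq q.
have q3 := quad_growth_near B q; have q0 := quad_growth_cst c.
have r1 := quad_growthZ b q1; have r2 := quad_growthZ a q2; have r3 := quad_growthZ a' q3.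
have t1 := quad_growthD q0 r1; have t2 := quad_growthD t1 r2.
by rewrite ED// ED// ED// E_cst !EZ// E_centred mulr0 addr0.
Qed.

Lemma quad_growth_centred_quad B e q (c b a a' : R) :
  quad_growth (fun k => c + b * centred e q k + a * centred e q k ^+ 2
        + a' * (centred e q k ^+ 2 * near_mean B q k)).
Proof.
have -> : (fun k => c + b * centred e q k + a * centred e q k ^+ 2
        + a' * (centred e q k ^+ 2 * near_mean B q k)) =
   (fun k => c + b * centred e q k + a * (k%:~R - lmean q) ^+ 2
        + a' * ((k%:~R - lmean q) ^+ 2 * near_mean B q k)).
  by apply/funext => k; rewrite !centred_sq.
apply: quad_growthD; last by apply: quad_growthZ; exact: quad_growth_near.
apply: quad_growthD; last by apply: quad_growthZ; exact: quad_growth_centred_sq.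
apply: quad_growthD; last by apply: quad_growthZ; exact: quad_growth_centred.
exact: quad_growth_cst.
Qed.

Definition Phi (A t : R) : R := if 0 <= t then t + A * t ^+ 2 else 0.

Lemma Phi_ge0 A t : 0 <= A -> 0 <= Phi A t.
Proof. by move=> A0; rewrite /Phi; case: ifP => // t0; rewrite addr_ge0 ?mulr_ge0 ?sqr_ge0. Qed.

Lemma Phi_neg A t : t < 0 -> Phi A t = 0.
Proof. by rewrite /Phi ltNge => /negPf ->. Qed.

Lemma Phi_ge A t : 0 <= A -> t <= Phi A t.
Proof.
move=> A0; rewrite /Phi; case: ifPn => [t0|]; last by rewrite -ltNge => /ltW.
by rewrite lerDl mulr_ge0 ?sqr_ge0.
Qed.

Lemma Phi_le A t : 0 <= A -> t <= 1 -> Phi A t <= 1 + A.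
Proof.
move=> A0 t1; rewrite /Phi; case: ifP => t0; last by rewrite addr_ge0.
by rewrite lerD// ler_piMr// expr_le1.
Qed.

(** Beyond the kink Phi is 0 and its quadratic expansion at t is nonpositive as
    long as the argument is at least - 1 / A.  Further out the expansion fails,
    but the tangent at t remains below Phi by convexity. *)
Lemma Phi_taylor A t xi (b : bool) : 0 <= A -> 0 <= t -> (b -> A * xi <= 1) ->
  t + A * t ^+ 2 - (1 + 2 * A * t) * xi + A * xi ^+ 2 * b%:R <= Phi A (t - xi).
Proof.
move=> A0 t0; rewrite /Phi; case: b => [/(_ isT) Axi|_].
  rewrite mulr1; case: ifPn => [h|]; last rewrite -ltNge => h.
    by rewrite le_eqVlt; apply/orP; left; apply/eqP; ring.
  have -> : t + A * t ^+ 2 - (1 + 2 * A * t) * xi + A * xi ^+ 2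
     = (t - xi) * (1 + A * (t - xi)) by ring.
  rewrite nmulr_rle0//; have := mulr_ge0 A0 t0; lra.
rewrite mulr0 addr0; case: ifPn => [h|]; last rewrite -ltNge => h.
  have := mulr_ge0 A0 (sqr_ge0 xi); nra.
have := mulr_ge0 A0 (sqr_ge0 t); have := mulr_ge0 A0 t0; nra.
Qed.

Variables (sg2 s0 B eta kap : R).
Hypotheses (sg2_gt0 : 0 < sg2) (s0_gt0 : 0 < s0) (B0 : 0 < B) (eta0 : 0 < eta)
  (eta2 : eta <= 1 / 2) (kap0 : 0 <= kap).

Definition regular q := lvar q <= sg2 /\ s0 <= trunc_var B q.

(** The curvature makes the gain 2 A s0 eta ^ 2 at the ends of the window exceed
    the loss kap + sg2 by 1; this margin absorbs the error terms of order
    1 / lam ^ 2. *)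
Definition curvature : R := (kap + sg2 + 1) / (2 * s0 * eta ^+ 2).
Definition decay_rate : R := 2 * curvature * (s0 + kap + sg2).

Lemma curvature_gt0 : 0 < curvature.
Proof.
rewrite /curvature divr_gt0 ?mulr_gt0 ?exprn_gt0//.
by move: sg2_gt0 kap0 => ? ?; lra.
Qed.

Lemma curvatureE : 2 * curvature * s0 * eta ^+ 2 = kap + sg2 + 1.
Proof.
rewrite /curvature; field.
by rewrite !gt_eqF.
Qed.

Lemma decay_rate_gt0 : 0 < decay_rate.
Proof.
by move: sg2_gt0 s0_gt0 kap0 curvature_gt0 => ? ? ? ?; apply: mulr_gt0; lra.
Qed.

Variable lam : R.
Hypotheses (lam0 : 0 < lam)
  (lam1 : curvature * (kap + B ^+ 2) ^+ 2 <= lam ^+ 2)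
  (lam2 : curvature * (kap + lam * B + B ^+ 2) <= lam ^+ 2).

(** With t = (rho - x ^ 2) / lam ^ 2, up to smaller terms the profile loses
    at most (1 + 2 A t) (kap + sg2) / lam ^ 2 to first order and gains at least
    2 A s0 x ^ 2 / lam ^ 4 to second order, where x ^ 2 / lam ^ 2 >= eta ^ 2 - t.
    The choice of A pays for the part of the loss that does not vanish with t,
    and the decay rate times t for the rest. *)
Lemma funnel_step q e (x rho dl : R) : regular q -> 0 <= dl <= kap ->
  eta ^+ 2 * lam ^+ 2 <= rho <= lam ^+ 2 / 4 ->
  (1 - decay_rate / lam ^+ 2) * Phi curvature ((rho - x ^+ 2) / lam ^+ 2) <=
  E q (fun k => Phi curvature ((rho - dl - (x + centred e q k) ^+ 2) / lam ^+ 2)).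
Proof.
move=> [varS tvs] /andP[dl0 dlk] /andP[rho1 rho2].
have A0 := curvature_gt0; have c0 := decay_rate_gt0.
move: (sg2_gt0) (s0_gt0) (B0) (kap0) (lam0) (lam1) (lam2) => S1 S2 S3 S4 S5 S6 S7.
have l20 : 0 < lam ^+ 2 by rewrite exprn_gt0.
set il := (lam ^+ 2)^-1.
have il0 : 0 < il by rewrite invr_gt0.
have ill : lam ^+ 2 * il = 1 by rewrite divff// gt_eqF.
have [t0|t0] := leP 0 ((rho - x ^+ 2) / lam ^+ 2); last first.
  rewrite (Phi_neg _ t0) mulr0; apply: E_ge0 => k; exact/Phi_ge0/ltW.
set t := (rho - x ^+ 2) / lam ^+ 2 in t0 *.
have x2rho : x ^+ 2 <= rho by move: t0; rewrite /t pmulr_lge0 ?subr_ge0// invr_gt0.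
set W := kap + B ^+ 2.
(* expansion of the profile at t, where the square of the increment is bounded by
   (2 x y + w) ^ 2 >= 2 x ^ 2 y ^ 2 - w ^ 2 *)
pose g k := (t + curvature * t ^+ 2 - (1 + 2 * curvature * t) * dl * il - curvature * il ^+ 2 * W ^+ 2)
  + (- (1 + 2 * curvature * t) * 2 * x * il) * centred e q k
  + (- (1 + 2 * curvature * t) * il) * centred e q k ^+ 2
  + (2 * curvature * il ^+ 2 * x ^+ 2) * (centred e q k ^+ 2 * near_mean B q k).
apply: (@le_trans _ _ (E q g)); last first.
  apply: E_le => [||k]; first exact: quad_growth_centred_quad.
    apply: (@quad_growth_bounded _ _ (1 + curvature)) => k.
    rewrite ger0_norm; last exact/Phi_ge0/ltW.
    apply: Phi_le => //; first exact: ltW.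
    rewrite ler_pdivrMr// mul1r; have := sqr_ge0 (x + centred e q k); lra.
  set y := centred e q k.
  have -> : (rho - dl - (x + y) ^+ 2) / lam ^+ 2 = t - (dl + 2 * x * y + y ^+ 2) * il.
    by rewrite /t /il; field; rewrite gt_eqF.
  have xb : `|x| <= lam / 2.
    rewrite -(@ler_pXn2r _ 2)// ?nnegrE//; last by rewrite divr_ge0// ltW.
    rewrite real_normK ?num_real// expr_div_n (_ : 2 ^+ 2 = 4); last by ring.
    exact: le_trans x2rho rho2.
  apply: (le_trans _ (@Phi_taylor curvature t _ (`|y| <= B)%R _ _ _)) => //; last 2 first.
  - exact: ltW.
  - move=> yB; rewrite mulrA ler_pdivrMr// mul1r; apply: le_trans lam2.
    rewrite ler_pM2l//.
    have h1 : `|x * y| <= lam / 2 * B by rewrite normrM ler_pM.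
    have h2 : y ^+ 2 <= B ^+ 2.
      by rewrite -(real_normK (num_real y)) ler_pXn2r ?nnegrE// ltW.
    have := ler_norm (x * y); lra.
  rewrite /g (near_meanP B e) -/y.
  case: (boolP (`|y| <= B)) => yB /=; rewrite ?mulr1 ?mulr0 ?addr0; last first.
    have := mulr_ge0 (mulr_ge0 (ltW A0) (sqr_ge0 il)) (sqr_ge0 W); lra.
  have h2 : y ^+ 2 <= B ^+ 2.
    by rewrite -(real_normK (num_real y)) ler_pXn2r ?nnegrE// ltW.
  have h3 : (dl + y ^+ 2) ^+ 2 <= W ^+ 2.
    have := sqr_ge0 y; have := sqr_ge0 B.
    by move=> ??; rewrite ler_pXn2r// ?nnegrE /W; lra.
  have h4 : 2 * (x * y) ^+ 2 - W ^+ 2 <= (dl + 2 * x * y + y ^+ 2) ^+ 2.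
    have := sqr_ge0 (2 * x * y + 2 * (dl + y ^+ 2)); nra.
  have h5 : 0 <= curvature * il ^+ 2 by rewrite mulr_ge0 ?sqr_ge0// ltW.
  have := ler_wpM2l h5 h4; lra.
rewrite /g E_centred_quad.
have xil : x ^+ 2 * il = rho * il - t by rewrite /t /il; ring.
have rhoil : eta ^+ 2 <= rho * il by rewrite ler_pdivlMr.
have xil0 : 0 <= x ^+ 2 * il by rewrite mulr_ge0 ?sqr_ge0// ltW.
have Wil : curvature * W ^+ 2 * il <= 1 by rewrite ler_pdivrMr// mul1r.
have PhiE : Phi curvature t = t + curvature * t ^+ 2 by rewrite /Phi t0.
rewrite PhiE.
have At : 0 <= curvature * t by rewrite mulr_ge0// ltW.
have h1 : (1 + 2 * curvature * t) * (dl + lvar q) <= (1 + 2 * curvature * t) * (kap + sg2).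
  by apply: ler_wpM2l; lra.
have h2 : 2 * curvature * s0 * (eta ^+ 2 - t) <= 2 * curvature * trunc_var B q * (x ^+ 2 * il).
  apply: (@le_trans _ _ (2 * curvature * s0 * (x ^+ 2 * il))).
    by apply: ler_wpM2l; [apply: mulr_ge0 => //; [lra|exact: ltW]|lra].
  by apply: ler_wpM2r => //; apply: ler_wpM2l => //; lra.
have h3 := mulr_ge0 (ltW c0) (mulr_ge0 (ltW A0) (sqr_ge0 t)).
have h4 := curvatureE.
have h5 : (1 + 2 * curvature * t) * (dl + lvar q) <=
   decay_rate * (t + curvature * t ^+ 2) + 2 * curvature * trunc_var B q * (x ^+ 2 * il) - curvature * W ^+ 2 * il.
  have -> : decay_rate * (t + curvature * t ^+ 2) = decay_rate * t + decay_rate * (curvature * t ^+ 2) by ring.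
  rewrite {1}/decay_rate; nra.
have := ler_wpM2l (ltW il0) h5.
by rewrite -/il; lra.
Qed.


(** Large enough for lvar q / wide_range to be at most half of s0 / (2 B). *)
Definition wide_range : R := 4 * B * sg2 / s0.

Hypotheses (s0_le : s0 <= sg2) (lam3 : 16 * B * (kap + wide_range ^+ 2) <= lam * s0).

Lemma centredN e q k : centred (~~ e) q k = - centred e q k.
Proof. by rewrite /centred; case: e => /=; ring. Qed.

(** At an end of the window the profile may vanish, but a step of order 1
    towards the centre is possible and the profile has slope of order 1 / lam
    there, while the negative part of its argument costs nothing.  The positive
    part y ^+ of the step restricted to the wide range is bounded below by
    y / 2 + y ^ 2 / (2 B) - y ^ 2 / wide_range, with the middle term restricted
    to deviations at most B; its mean involves second moments only. *)
Lemma boost_step q e (x dl : R) : regular q -> 0 <= dl <= kap ->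
  lam / 4 <= `|x| <= lam / 2 ->
  s0 / (16 * B * lam) <=
  E q (fun k => Phi curvature ((lam ^+ 2 / 4 - dl - (x + centred e q k) ^+ 2) / lam ^+ 2)).
Proof.
move=> [varS tvs] /andP[dl0 dlk] /andP[x1 x2].
have A0 := curvature_gt0.
move: (sg2_gt0) (s0_gt0) (B0) (kap0) (lam0) (s0_le) (lam3) => S1 S2 S3 S4 S5 S6 S7.
have l20 : 0 < lam ^+ 2 by rewrite exprn_gt0.
set il := (lam ^+ 2)^-1.
have il0 : 0 < il by rewrite invr_gt0.
have B2B : B <= wide_range.
  rewrite /wide_range ler_pdivlMr//; have := ler_wpM2l (ltW S3) S6.
  have := mulr_gt0 S3 S1; lra.
have B20 : 0 < wide_range by exact: lt_le_trans B2B.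
pose e' := if x <= 0 then e else ~~ e.
pose y k := centred e' q k.
have xyE k : x * centred e q k = - (`|x| * y k).
  rewrite /y /e'; case: ifPn => [x0|]; first by rewrite ler0_norm// mulNr opprK.
  by rewrite -ltNge => x0; rewrite centredN gtr0_norm//; ring.
have yyE k : centred e q k ^+ 2 = y k ^+ 2.
  by rewrite /y /e'; case: ifP => // _; rewrite centredN sqrrN.
pose h k := y k / 2 + y k ^+ 2 * near_mean B q k / (2 * B) - y k ^+ 2 / wide_range.
have hle k : y k <= 0 \/ wide_range < y k -> h k <= 0.
  rewrite /h (near_meanP B e') -/(y k); have y2 := sqr_ge0 (y k).
  case: (leP `|y k| B) => yB /= [yk|yk].
  - rewrite mulr1; move: yB; rewrite ler0_norm// => yB.
    have y1 : y k ^+ 2 <= - y k * B by nra.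
    have : y k ^+ 2 / (2 * B) <= - y k / 2.
      by rewrite ler_pdivrMr ?mulr_gt0//; lra.
    have : 0 <= y k ^+ 2 / wide_range by rewrite divr_ge0// ltW.
    lra.
  - by move: yB; rewrite gtr0_norm; lra.
  - rewrite mulr0 mul0r addr0.
    have : 0 <= y k ^+ 2 / wide_range by rewrite divr_ge0// ltW.
    lra.
  - rewrite mulr0 mul0r addr0.
    have : y k <= y k ^+ 2 / wide_range by rewrite ler_pdivlMr//; nra.
    lra.
have hle2 k : 0 <= y k -> h k <= y k.
  move=> yk; rewrite /h (near_meanP B e') -/(y k).
  have y2 : 0 <= y k ^+ 2 / wide_range by rewrite divr_ge0 ?sqr_ge0// ltW.
  case: (leP `|y k| B) => yB /=; last by rewrite mulr0 mul0r; lra.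
  rewrite mulr1; move: yB; rewrite ger0_norm// => yB.
  have : y k ^+ 2 / (2 * B) <= y k / 2.
    by rewrite ler_pdivrMr ?mulr_gt0//; nra.
  lra.
pose g k := - (kap + wide_range ^+ 2) * il + (lam / 4 * il) * y k
   + (- (lam / 2 * il) / wide_range) * y k ^+ 2
   + (lam / 2 * il / (2 * B)) * (y k ^+ 2 * near_mean B q k).
have gE k : g k = il * (lam / 2 * h k - (kap + wide_range ^+ 2)).
  rewrite /g /h; field; rewrite !gt_eqF//.
apply: (@le_trans _ _ (E q g)).
  rewrite /g E_centred_quad.
  have h1 : lvar q / wide_range <= s0 / (4 * B).
    rewrite /wide_range invf_div mulrA ler_pdivrMr; last by rewrite !mulr_gt0.
    have -> : s0 / (4 * B) * (4 * B * sg2) = sg2 * s0.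
      by field; rewrite gt_eqF.
    by rewrite ler_pM2r.
  have h2 : s0 / (2 * B) <= trunc_var B q / (2 * B).
    by rewrite ler_pM2r ?invr_gt0 ?mulr_gt0.
  have h3 : kap + wide_range ^+ 2 <= lam * s0 / (16 * B).
    by rewrite ler_pdivlMr ?mulr_gt0//; lra.
  have -> : s0 / (16 * B * lam) = il * (lam * s0 / (16 * B)).
    by rewrite /il; field; rewrite !gt_eqF.
  have -> : - (kap + wide_range ^+ 2) * il + - (lam / 2 * il) / wide_range * lvar q +
     lam / 2 * il / (2 * B) * trunc_var B q =
    il * (lam / 2 * (trunc_var B q / (2 * B) - lvar q / wide_range) - (kap + wide_range ^+ 2)).
    by ring.
  rewrite ler_pM2l//.
  have h4 : s0 / (4 * B) <= trunc_var B q / (2 * B) - lvar q / wide_range.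
    have -> : s0 / (4 * B) = s0 / (2 * B) - s0 / (4 * B).
      by field; rewrite gt_eqF.
    lra.
  have l2 : 0 <= lam / 2 by lra.
  have := ler_wpM2l l2 h4.
  have -> : lam / 2 * (s0 / (4 * B)) = 2 * (lam * s0 / (16 * B)).
    by field; rewrite gt_eqF.
  lra.
apply: E_le => [||k]; first exact: quad_growth_centred_quad.
  apply: (@quad_growth_bounded _ _ (1 + curvature)) => k.
  rewrite ger0_norm; last exact/Phi_ge0/ltW.
  apply: Phi_le => //; first exact: ltW.
  rewrite ler_pdivrMr// mul1r; have := sqr_ge0 (x + centred e q k); lra.
rewrite gE; have [yk|yk] := boolP (0 < y k <= wide_range); last first.
  apply: le_trans (Phi_ge0 _ (ltW A0)); rewrite pmulr_rle0//.
  suff : lam / 2 * h k <= 0 by have := sqr_ge0 wide_range; lra.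
  rewrite pmulr_rle0 ?divr_gt0//; apply: hle.
  by move: yk; rewrite negb_and -leNgt -ltNge => /orP.
move: yk => /andP[y0 yB2]; apply: le_trans (Phi_ge _ (ltW A0)).
rewrite mulrC ler_pM2r//.
have -> : (x + centred e q k) ^+ 2 = x ^+ 2 - 2 * (`|x| * y k) + y k ^+ 2.
  by rewrite -yyE -[_ * y k]opprK -xyE; ring.
have x24 : x ^+ 2 <= lam ^+ 2 / 4.
  by rewrite -(real_normK (num_real x)); have := normr_ge0 x; nra.
have yB22 : y k ^+ 2 <= wide_range ^+ 2 by nra.
have h1 := hle2 k (ltW y0).
have h2 : lam / 2 * h k <= lam / 2 * y k by rewrite ler_wpM2l//; lra.
have h3 : lam / 4 * y k <= `|x| * y k by rewrite ler_wpM2r// ltW.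
lra.
Qed.

Definition start_gain : R := Num.min (1 / 8) (s0 / (32 * B)).

Lemma start_gain_gt0 : 0 < start_gain.
Proof.
by rewrite /start_gain lt_min divr_gt0//= divr_gt0// mulr_gt0.
Qed.

Hypotheses (lam4 : 4 <= lam) (lam5 : 2 * decay_rate <= lam ^+ 2).

Lemma contraction_ge : 1 / 2 <= 1 - decay_rate / lam ^+ 2 <= 1.
Proof.
move: (lam0) (lam5) => h1 h2; have c0 := decay_rate_gt0.
have l20 : 0 < lam ^+ 2 by rewrite exprn_gt0.
have : 0 <= decay_rate / lam ^+ 2 by rewrite divr_ge0// ltW.
have : decay_rate / lam ^+ 2 <= 1 / 2 by rewrite ler_pdivrMr//; lra.
by move=> ??; apply/andP; split; lra.
Qed.

(** Within distance 1 of an end the gain comes from the kink, elsewhere the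
    profile itself is already of order (distance + 1) / lam. *)
Lemma first_step q e (x dl : R) : regular q -> 0 <= dl <= kap -> `|x| <= lam / 2 ->
  start_gain * (lam / 2 - `|x| + 1) / lam <=
  E q (fun k => Phi curvature ((lam ^+ 2 / 4 - dl - (x + centred e q k) ^+ 2) / lam ^+ 2)).
Proof.
move=> rq dlk xl; have A0 := curvature_gt0; have /andP[c1 c2] := contraction_ge.
move: (s0_gt0) (B0) (lam0) (lam4) (eta0) (eta2) start_gain_gt0 => S1 S2 S3 S4 S5 S6 S7.
have x0 := normr_ge0 x.
have l20 : 0 < lam ^+ 2 by rewrite exprn_gt0.
have fb1 : start_gain <= 1 / 8 by rewrite /start_gain ge_min lexx.
have fb2 : start_gain <= s0 / (32 * B) by rewrite /start_gain ge_min lexx orbT.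
have [d1|d1] := leP 1 (lam / 2 - `|x|).
  have rho0 : eta ^+ 2 * lam ^+ 2 <= lam ^+ 2 / 4 <= lam ^+ 2 / 4.
    by rewrite lexx andbT mulrC ler_pM2l//; nra.
  apply: le_trans (funnel_step e x rq dlk rho0).
  set t := (lam ^+ 2 / 4 - x ^+ 2) / lam ^+ 2.
  have tE : t = (lam / 2 - `|x|) * (lam / 2 + `|x|) / lam ^+ 2.
    by rewrite /t -(real_normK (num_real x)); congr (_ / _); field.
  have t1 : (lam / 2 - `|x|) / 2 / lam <= t.
    rewrite tE ler_pdivlMr//.
    have -> : (lam / 2 - `|x|) / 2 / lam * lam ^+ 2 = (lam / 2 - `|x|) * (lam / 2).
      by field; rewrite gt_eqF.
    by rewrite ler_pM2l; lra.
  have t0 : 0 <= t by apply: le_trans t1; rewrite !divr_ge0//; lra.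
  have h1 : t <= Phi curvature t by exact/Phi_ge/ltW.
  apply: (@le_trans _ _ (1 / 2 * t)); last by rewrite ler_pM//; lra.
  apply: (@le_trans _ _ (1 / 2 * ((lam / 2 - `|x|) / 2 / lam))); last first.
    by rewrite ler_pM2l//; lra.
  rewrite !mulrA ler_pM2r ?invr_gt0//.
  apply: (@le_trans _ _ (1 / 8 * (lam / 2 - `|x| + 1))); last by lra.
  by rewrite ler_wpM2r//; lra.
apply: le_trans (boost_step e rq dlk _); last by apply/andP; split; lra.
have -> : s0 / (16 * B * lam) = s0 / (32 * B) * 2 / lam by field; rewrite !gt_eqF.
by rewrite ler_pM2r ?invr_gt0// ler_pM//; lra.
Qed.

End funnel.

(** * Staying in the window and ending near its centre *)

Section landing.
Context {R : realType}.
Variables (p : nat -> law R) (x0 : R).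

(** The walk is followed through its integer part s; x0 and the means of the steps
    turn s into a position relative to the centre of the window. *)
Definition cpos (j : nat) (s : int) : R := x0 + s%:~R - mean_sum p 0 j.

Lemma mean_sum0S j : mean_sum p 0 j.+1 = mean_sum p 0 j + lmean (p j).
Proof. by rewrite /mean_sum !add0n big_nat_recr. Qed.

Lemma cpos_shift j s k : cpos j.+1 (s + k) = cpos j s + centred false (p j) k.
Proof. by rewrite /cpos mean_sum0S /centred intrD; ring. Qed.

Lemma cpos_coshift j s k : cpos j (s - k) = cpos j.+1 s + centred true (p j) k.
Proof. by rewrite /cpos mean_sum0S /centred intrD mulrNz; ring. Qed.

Variables (lam eta : R).

Definition win (j : nat) (s : int) : bool := (`|cpos j s| <= lam / 2)%R.
Definition mid (j : nat) (s : int) : R := (`|cpos j s| <= eta * lam)%R%:R.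

Lemma quad_growth_mid j : quad_growth (mid j).
Proof. by apply: quad_growth01 => s; rewrite /mid ler0n lern1 leq_b1. Qed.

Variables (sg2 s0 B kap : R).
Hypotheses (sg2_gt0 : 0 < sg2) (s0_gt0 : 0 < s0) (B0 : 0 < B) (eta0 : 0 < eta)
  (eta2 : eta <= 1 / 2) (kap0 : 0 <= kap) (s0_le : s0 <= sg2).
Hypothesis reg : forall i, regular sg2 s0 B (p i).
Local Notation A := (curvature sg2 s0 eta kap).
Local Notation c := (decay_rate sg2 s0 eta kap).

Definition lam_large : Prop :=
  [/\ A * (kap + B ^+ 2) ^+ 2 <= lam ^+ 2,
      A * (kap + lam * B + B ^+ 2) <= lam ^+ 2,
      16 * B * (kap + wide_range sg2 s0 B ^+ 2) <= lam * s0,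
      4 <= lam & 2 * c <= lam ^+ 2].
Hypothesis lamL : lam_large.

Lemma lam_large_gt0 : 0 < lam.
Proof. by case: lamL => _ _ _ h _; apply: lt_le_trans h. Qed.

(** Squared half-width of the funnel r steps before the end: that of the target
    interval for r = 0, growing linearly until it fills the window. *)
Definition rho (r : nat) : R :=
  Num.min (eta ^+ 2 * lam ^+ 2 + kap * r%:R) (lam ^+ 2 / 4).

Lemma rho_itv r : eta ^+ 2 * lam ^+ 2 <= rho r <= lam ^+ 2 / 4.
Proof.
move: (eta0) (eta2) => h1 h2; have l0 := lam_large_gt0.
rewrite /rho ge_min lexx orbT andbT le_min lerDl mulr_ge0//=.
have l20 : 0 < lam ^+ 2 by rewrite exprn_gt0.
by rewrite mulrC ler_pM2l//; nra.
Qed.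

Lemma rho0 : rho 0 = eta ^+ 2 * lam ^+ 2.
Proof.
rewrite /rho mulr0 addr0; apply/min_idPl.
by have /andP[] := rho_itv 0; rewrite /rho mulr0 addr0 => h1 h2; apply: le_trans h1 _;
  rewrite ge_min lexx orbT.
Qed.

Lemma rho_step r : 0 <= rho r.+1 - rho r <= kap.
Proof.
have k0 := kap0; rewrite /rho -natr1; set a := eta ^+ 2 * lam ^+ 2.
set b := lam ^+ 2 / 4.
have -> : a + kap * (r%:R + 1) = a + kap * r%:R + kap by ring.
set d := a + kap * r%:R.
by case: (leP d b) => h1; case: (leP (d + kap) b) => h2; apply/andP; split; lra.
Qed.

Definition hat r (x : R) : R := Phi A ((rho r - x ^+ 2) / lam ^+ 2).

Lemma hat01 r x : 0 <= hat r x <= 1 + A.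
Proof.
have l0 := lam_large_gt0; have l20 : 0 < lam ^+ 2 by rewrite exprn_gt0.
have A0 : 0 < A by exact: curvature_gt0.
rewrite /hat (Phi_ge0 _ (ltW A0)) /=; apply: Phi_le; first exact: ltW.
rewrite ler_pdivrMr// mul1r.
by have /andP[_] := rho_itv r; have := sqr_ge0 x; lra.
Qed.

Lemma hat_gt0 r x : hat r x != 0 -> x ^+ 2 <= rho r.
Proof.
have l0 := lam_large_gt0; have l20 : 0 < lam ^+ 2 by rewrite exprn_gt0.
apply: contraNT; rewrite -ltNge => h; apply/eqP/Phi_neg.
by rewrite pmulr_llt0 ?invr_gt0// subr_lt0.
Qed.

Lemma hat_win r j s : hat r (cpos j s) != 0 -> win j s.
Proof.
have l0 := lam_large_gt0.
move/hat_gt0 => h; rewrite /win -(@ler_pXn2r _ 2)// ?nnegrE ?divr_ge0 ?(ltW l0)//.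
rewrite real_normK ?num_real//; have /andP[_] := rho_itv r.
have -> : (lam / 2) ^+ 2 = lam ^+ 2 / 4 by field.
exact: le_trans.
Qed.

Lemma hat0_mid j s : hat 0 (cpos j s) <= (1 + A) * mid j s.
Proof.
have l0 := lam_large_gt0; have e0 := eta0.
have [h|] := eqVneq (hat 0 (cpos j s)) 0.
  rewrite h mulr_ge0//; have : 0 < A by exact: curvature_gt0.
  lra.
move/hat_gt0; rewrite rho0 => h; rewrite /mid.
have -> : `|cpos j s| <= eta * lam.
  rewrite -(@ler_pXn2r _ 2)// ?nnegrE; last by rewrite mulr_ge0// ltW.
  by rewrite real_normK ?num_real// exprMn.
by rewrite mulr1; have /andP[] := hat01 0 (cpos j s).
Qed.

Lemma hat_step q e r x : regular sg2 s0 B q ->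
  (1 - c / lam ^+ 2) * hat r.+1 x <= E q (fun k => hat r (x + centred e q k)).
Proof.
move=> rq; case: lamL => l1 l2 l3 l4 l5.
have l0 := lam_large_gt0.
have h := @funnel_step R sg2 s0 B eta kap sg2_gt0 s0_gt0 B0 eta0 kap0 lam l0 l1 l2
  q e x (rho r.+1) (rho r.+1 - rho r) rq (rho_step r) (rho_itv r.+1).
apply: le_trans h _; rewrite le_eqVlt; apply/orP; left; apply/eqP.
by apply: eq_E => k; rewrite /hat; congr (Phi _ ((_ - _) / _)); ring.
Qed.

Lemma quad_growth_hat r (h : int -> R) : quad_growth (fun k => hat r (h k)).
Proof.
apply: (@quad_growth_bounded _ _ (1 + A)) => k.
by have /andP[h1 h2] := hat01 r (h k); rewrite ger0_norm.
Qed.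

Lemma contraction_ge0 : 0 <= 1 - c / lam ^+ 2.
Proof.
case: lamL => l1 l2 l3 l4 l5; have l0 := lam_large_gt0.
have /andP[] := @contraction_ge R sg2 s0 eta kap sg2_gt0 s0_gt0 eta0 kap0 lam l0 l5; lra.
Qed.

(** The profile vanishes outside the window, so killing costs nothing. *)
Lemma forward_landing n i s :
  (1 - c / lam ^+ 2) ^+ n * hat n (cpos i s)
    <= (1 + A) * run p win i n (mid (i + n)) s.
Proof.
elim: n i s => [|n IH] i s; first by rewrite expr0 mul1r addn0; exact: hat0_mid.
have A0 : 0 < A by exact: curvature_gt0.
have c1 := contraction_ge0; rewrite /= -addSnnS.
set f := run _ _ _ _ _.
have qf : quad_growth (fun s => (win i.+1 s)%:R * f s).
  by apply: quad_growth_kill; apply: quad_growth_run; exact: quad_growth_mid.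
apply: (@le_trans _ _ (E (p i) (fun k => (1 - c / lam ^+ 2) ^+ n
    * hat n (cpos i s + centred false (p i) k)))).
  rewrite EZ; last exact: quad_growth_hat.
  by rewrite exprSr -mulrA ler_wpM2l ?exprn_ge0// hat_step.
rewrite /shift -EZ; last exact: (quad_growth_comp false s qf).
apply: E_le => [||k].
- by apply: quad_growthZ; exact: quad_growth_hat.
- exact: quad_growthZ (quad_growth_comp false s qf).
rewrite -cpos_shift.
have [->|hw] := eqVneq (hat n (cpos i.+1 (s + k))) 0; last first.
  by rewrite (hat_win hw) mul1r; exact: IH.
rewrite mulr0 !mulr_ge0 ?ler0n//; first by lra.
by apply: run_ge0 => z; rewrite /mid ler0n.
Qed.

Lemma backward_landing n i s : 
  (1 - c / lam ^+ 2) ^+ n * hat n (cpos (i + n) s)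
    <= (1 + A) * corun p win i n (mid i) s.
Proof.
elim: n s => [|n IH] s; first by rewrite expr0 mul1r addn0; exact: hat0_mid.
have A0 : 0 < A by exact: curvature_gt0.
have c1 := contraction_ge0; rewrite /= .
have [->|hw] := eqVneq (hat n.+1 (cpos (i + n.+1) s)) 0.
  rewrite mulr0 !mulr_ge0 ?ler0n//; first by lra.
  apply: shift_ge0 => z; have := IH z.
  have : 0 <= (1 - c / lam ^+ 2) ^+ n * hat n (cpos (i + n) z).
    by rewrite mulr_ge0 ?exprn_ge0//; have /andP[] := hat01 n (cpos (i + n) z).
  move=> h1 h2; have := le_trans h1 h2; rewrite pmulr_rge0//; lra.
rewrite (hat_win hw) mul1r.
set f := corun _ _ _ _ _.
have qf : quad_growth f by apply: quad_growth_corun; exact: quad_growth_mid.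
apply: (@le_trans _ _ (E (p (i + n)%N) (fun k => (1 - c / lam ^+ 2) ^+ n
    * hat n (cpos (i + n).+1 s + centred true (p (i + n)%N) k)))).
  rewrite EZ; last exact: quad_growth_hat.
  by rewrite exprSr -mulrA addnS ler_wpM2l ?exprn_ge0// hat_step.
rewrite /shift -EZ; last exact: (quad_growth_comp true s qf).
apply: E_le => [||k].
- by apply: quad_growthZ; exact: quad_growth_hat.
- exact: quad_growthZ (quad_growth_comp true s qf).
by rewrite -cpos_coshift; exact: IH.
Qed.

Lemma hat_first q e n x : regular sg2 s0 B q ->
  lam ^+ 2 / 4 <= eta ^+ 2 * lam ^+ 2 + kap * n.+1%:R -> `|x| <= lam / 2 ->
  start_gain s0 B * (lam / 2 - `|x| + 1) / lam <= E q (fun k => hat n (x + centred e q k)).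
Proof.
move=> rq rn xl; case: lamL => l1 l2 l3 l4 l5.
have l0 := lam_large_gt0.
have h := @first_step R sg2 s0 B eta kap sg2_gt0 s0_gt0 B0 eta0 eta2 kap0 lam l0 l1 l2
  s0_le l3 l4 l5 q e x (rho n.+1 - rho n) rq (rho_step n) xl.
apply: le_trans h _; rewrite le_eqVlt; apply/orP; left; apply/eqP.
apply: eq_E => k; rewrite /hat; congr (Phi _ ((_ - _) / _)).
by rewrite {1}/rho (min_idPr rn); ring.
Qed.

(** The assumption on the number of steps says that the funnel fills the whole
    window at the start, so that the first step can be taken from its ends. *)
Lemma forward_landing_first n i s : `|cpos i s| <= lam / 2 ->
  lam ^+ 2 / 4 <= eta ^+ 2 * lam ^+ 2 + kap * n.+1%:R ->
  (1 - c / lam ^+ 2) ^+ n * (start_gain s0 B * (lam / 2 - `|cpos i s| + 1) / lam)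
    <= (1 + A) * run p win i n.+1 (mid (i + n.+1)) s.
Proof.
move=> xl rn; have A0 : 0 < A by exact: curvature_gt0.
have c1 := contraction_ge0; rewrite /= -addSnnS.
set f := run _ _ _ _ _.
have qf : quad_growth (fun s => (win i.+1 s)%:R * f s).
  by apply: quad_growth_kill; apply: quad_growth_run; exact: quad_growth_mid.
apply: (@le_trans _ _ (E (p i) (fun k => (1 - c / lam ^+ 2) ^+ n
    * hat n (cpos i s + centred false (p i) k)))).
  rewrite EZ; last exact: quad_growth_hat.
  by rewrite ler_wpM2l ?exprn_ge0// hat_first.
rewrite /shift -EZ; last exact: (quad_growth_comp false s qf).
apply: E_le => [||k].
- by apply: quad_growthZ; exact: quad_growth_hat.
- exact: quad_growthZ (quad_growth_comp false s qf).
rewrite -cpos_shift.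
have [->|hw] := eqVneq (hat n (cpos i.+1 (s + k))) 0; last first.
  by rewrite (hat_win hw) mul1r; exact: forward_landing.
rewrite mulr0 !mulr_ge0 ?ler0n//; first by lra.
by apply: run_ge0 => z; rewrite /mid ler0n.
Qed.

Lemma backward_landing_first n i s : win (i + n.+1) s ->
  lam ^+ 2 / 4 <= eta ^+ 2 * lam ^+ 2 + kap * n.+1%:R ->
  (1 - c / lam ^+ 2) ^+ n * (start_gain s0 B * (lam / 2 - `|cpos (i + n.+1) s| + 1) / lam)
    <= (1 + A) * corun p win i n.+1 (mid i) s.
Proof.
move=> ws rn; have A0 : 0 < A by exact: curvature_gt0.
have c1 := contraction_ge0; rewrite /= ws mul1r.
set f := corun _ _ _ _ _.
have qf : quad_growth f by apply: quad_growth_corun; exact: quad_growth_mid.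
apply: (@le_trans _ _ (E (p (i + n)%N) (fun k => (1 - c / lam ^+ 2) ^+ n
    * hat n (cpos (i + n).+1 s + centred true (p (i + n)%N) k)))).
  rewrite EZ; last exact: quad_growth_hat.
  by rewrite addnS ler_wpM2l ?exprn_ge0// hat_first// -addnS.
rewrite /shift -EZ; last exact: (quad_growth_comp true s qf).
apply: E_le => [||k].
- by apply: quad_growthZ; exact: quad_growth_hat.
- exact: quad_growthZ (quad_growth_comp true s qf).
by rewrite -cpos_coshift; exact: backward_landing.
Qed.

End landing.

(** * Binomial weights *)

Section binomial_weights.
Context {R : realType}.

(** Stated over the integers and by the recursion of a fair coin, which is the
    form that the block decomposition produces. *)
Fixpoint binom_weight (j : nat) (k : int) : R :=
  if j is i.+1 then (binom_weight i k + binom_weight i (k - 1)) / 2 else (k == 0)%:R.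

Lemma binom_weight01 j k : 0 <= binom_weight j k <= 1.
Proof.
elim: j k => [|j IH] k /=; first by rewrite ler0n lern1 leq_b1.
have /andP[h1 h2] := IH k; have /andP[h3 h4] := IH (k - 1).
by apply/andP; split; lra.
Qed.

Lemma binom_weightE j k : binom_weight j k = if k is Posz m then 'C(j, m)%:R / 2 ^+ j else 0.
Proof.
elim: j k => [|j IH] [m|m] /=; rewrite ?expr0 ?divr1//.
- by case: m.
- rewrite !IH; case: m => [|m].
    by rewrite /= !bin0 addr0 exprS; field; rewrite expf_neq0.
  have -> : (Posz m.+1 - 1)%R = Posz m by lia.
  rewrite binS natrD exprS; field; rewrite expf_neq0//.
- rewrite !IH (_ : Negz m - 1 = Negz m.+1); last by lia.
  by rewrite addr0 mul0r.
Qed.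

Lemma bin_center_succ h d : (h + d).+1%:R * 'C(h.*2, (h + d).+1)%:R
   = (h%:R - d%:R) * 'C(h.*2, h + d)%:R :> R.
Proof.
have [dh|hd] := leqP d h.
  rewrite -natrM mul_bin_left natrM; congr (_ * _).
  by rewrite -natrB//; congr (_%:R); lia.
rewrite !bin_small ?mulr0//; lia.
Qed.

Lemma bin_center_max h k : 'C(h.*2, k)%:R <= 'C(h.*2, h)%:R :> R.
Proof.
have up d : 'C(h.*2, h + d)%:R <= 'C(h.*2, h)%:R :> R.
  elim: d => [|d IH]; first by rewrite addn0.
  apply: le_trans IH; rewrite addnS.
  have h0 : 0 < (h + d).+1%:R :> R by rewrite ltr0n.
  rewrite -(ler_pM2l h0) bin_center_succ ler_wpM2r ?ler0n//.
  rewrite -natr1 natrD; have := ler0n R d; lra.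
have [hk|kh] := leqP h k; first by rewrite -(subnKC hk).
rewrite -(bin_sub (_ : k <= h.*2)%N); last by lia.
have -> : (h.*2 - k = h + (h - k))%N by lia.
exact: up.
Qed.

(** Both bounds on the central coefficient propagate from h to h + 1 because
    (2 h + 1) (2 h + 3) <= 4 (h + 1) ^ 2 and 4 h (h + 1) <= (2 h + 1) ^ 2. *)
Lemma bin_center_sq h :
  (h.*2.+1)%:R * 'C(h.*2, h)%:R ^+ 2 <= (2 ^+ h.*2) ^+ 2 :> R
  /\ ((0 < h)%N -> (2 ^+ h.*2) ^+ 2 <= (4 * h)%:R * 'C(h.*2, h)%:R ^+ 2 :> R).
Proof.
elim: h => [|h [IH1 IH2]]; first by rewrite /= bin0 expr1n mulr1.
have rec : (h.+1)%:R * 'C(h.+1.*2, h.+1)%:R = 2 * (h.*2.+1)%:R * 'C(h.*2, h)%:R :> R.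
  rewrite -!natrM; congr (_%:R).
  have e1 := mul_bin_diag h.*2.+1 h.
  have e2 := mul_bin_left h.*2.+1 h.
  have e3 := mul_bin_down h.*2.+1 h; rewrite doubleS.
  have e4 : ('C(h.*2.+2, h.+1) = 'C(h.*2.+1, h) + 'C(h.*2.+1, h.+1))%N by rewrite binS addnC.
  have e5 : ('C(h.*2.+1, h) = 'C(h.*2.+1, h.+1))%N.
    by rewrite -[LHS]bin_sub; [congr ('C(_, _)); lia|lia].
  have e6 : (h.*2.+1 - h = h.+1)%N by lia.
  move: e3; rewrite e6 /= => e3; rewrite e4 -e5; nia.
set b := 'C(h.*2, h)%:R in IH1 IH2 rec; set b' := 'C(h.+1.*2, h.+1)%:R in rec *.
set x : R := h%:R.
have x0 : 0 <= x by rewrite ler0n.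
have n1 : (h.+1)%:R = x + 1 :> R by rewrite -natr1.
have n2 : (h.*2.+1)%:R = 2 * x + 1 :> R by rewrite -natr1 -mul2n natrM.
have n3 : (h.+1.*2.+1)%:R = 2 * x + 3 :> R.
  by rewrite -natr1 -mul2n natrM n1; ring.
have n4 : (4 * h.+1)%:R = 4 * (x + 1) :> R by rewrite natrM n1.
have n5 : (2 : R) ^+ h.+1.*2 = 4 * 2 ^+ h.*2 by rewrite doubleS !exprS; ring.
rewrite n1 n2 in rec; rewrite n2 in IH1; rewrite n3 n4 n5.
set P := (2 : R) ^+ h.*2 in IH1 IH2 *.
have b'E : b' = 2 * (2 * x + 1) * b / (x + 1).
  by rewrite -rec; field; lra.
have x1 : 0 < x + 1 by lra.
have E : b' ^+ 2 * (x + 1) ^+ 2 = 4 * (2 * x + 1) ^+ 2 * b ^+ 2.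
  by rewrite b'E; field; lra.
have x12 : 0 < (x + 1) ^+ 2 by rewrite exprn_gt0.
have b2 := sqr_ge0 b.
split.
  rewrite -(ler_pM2r x12) -mulrA E.
  have := ler_wpM2l (_ : 0 <= 4 * (2 * x + 3) * (2 * x + 1)) IH1.
  move=> /(_ ltac:(nra)).
  have : 0 <= P ^+ 2 by exact: sqr_ge0.
  nra.
move=> _; rewrite -(ler_pM2r x12) -[leRHS]mulrA E.
have [h0|h0] := posnP h.
  have -> : x = 0 by rewrite /x h0.
  have -> : b = 1 by rewrite /b h0 bin0.
  by rewrite (_ : P = 1) ?/P ?h0//; lra.
have IH3 := IH2 h0; rewrite natrM -/x in IH3.
have h1 : 4 * x * b ^+ 2 * (4 * (x + 1) ^+ 2 ) <= 4 * (x+1) * (4 * (2 * x + 1) ^+ 2 * b ^+ 2).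
  nra.
have := ler_wpM2r (_ : 0 <= 4 * (x + 1) ^+ 2) IH3.
move=> /(_ ltac:(nra)); lra.
Qed.

(** An odd row is the mean of two neighbours in an even row, so the central
    coefficients of even rows bound all weights. *)
Lemma binom_weight_upper j k : j%:R * binom_weight j k ^+ 2 <= 1.
Proof.
have even h z : h.*2.+1%:R * binom_weight h.*2 z ^+ 2 <= 1.
  rewrite binom_weightE; case: z => m; last by rewrite expr0n mulr0.
  have [h1 _] := bin_center_sq h.
  rewrite expr_div_n mulrA ler_pdivrMr ?exprn_gt0// mul1r.
  apply: le_trans h1; rewrite ler_wpM2l// ler_pXn2r ?nnegrE//.
  exact: bin_center_max.
rewrite -(odd_double_half j); case: (odd j) => /=; last first.
  rewrite add0n; apply: le_trans (even j./2 k); rewrite ler_wpM2r ?sqr_ge0//.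
  by rewrite ler_nat.
rewrite add1n /=; set h := j./2.
have h1 := even h k; have h2 := even h (k - 1).
have h3 : 0 <= (h.*2.+1)%:R :> R by [].
have := mulr_ge0 h3 (sqr_ge0 (binom_weight h.*2 k - binom_weight h.*2 (k - 1))).
lra.
Qed.

Lemma expR_le_lin (x : R) : 0 <= x <= 1 / 2 -> expR (- (2 * x)) <= 1 - x.
Proof.
move=> /andP[x0 x1]; rewrite expRN.
have h := expR_ge1Dx (2 * x).
rewrite invf_ple ?posrE ?expR_gt0//; last by lra.
apply: le_trans h; rewrite -[leLHS]mul1r ler_pdivrMr; [nra|lra].
Qed.

(** Each of the d steps away from the centre multiplies the coefficient by at
    least 1 - 2 d / h. *)
Lemma bin_center_lower h d : (0 < h)%N -> (4 * d <= h)%N ->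
  'C(h.*2, h)%:R * expR (- (4 * d%:R ^+ 2 / h%:R)) <= 'C(h.*2, h + d)%:R :> R.
Proof.
move=> h0 dh.
have hr : 0 < h%:R :> R by rewrite ltr0n.
have dhr : 4 * d%:R <= h%:R :> R by rewrite -natrM ler_nat.
have d0 : 0 <= d%:R :> R by [].
set r : R := 1 - 2 * d%:R / h%:R.
have rh : r * h%:R = h%:R - 2 * d%:R by rewrite /r; field; rewrite gt_eqF.
have r0 : 0 <= r.
  rewrite -(ler_pM2r hr) mul0r rh; lra.
have r1 : r <= 1 by rewrite -(ler_pM2r hr) mul1r rh; lra.
have step i : (i <= d)%N -> 'C(h.*2, h)%:R * r ^+ i <= 'C(h.*2, h + i)%:R :> R.
  elim: i => [|i IH] id; first by rewrite expr0 mulr1 addn0.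
  have i0 : 0 < (h + i).+1%:R :> R by rewrite ltr0n.
  rewrite addnS -(ler_pM2l i0) bin_center_succ.
  have := IH (ltnW id); set C := 'C(_, h + i)%:R; set C0 := 'C(_, h)%:R => {}IH.
  have C00 : 0 <= C by [].
  apply: (@le_trans _ _ ((h%:R - i%:R) * (C0 * r ^+ i))); last first.
    rewrite ler_wpM2l// subr_ge0 ler_nat; lia.
  have -> : (h + i).+1%:R * (C0 * r ^+ i.+1) = (r * (h + i).+1%:R) * (C0 * r ^+ i).
    by rewrite exprS; ring.
  apply: ler_wpM2r; first by rewrite mulr_ge0 ?exprn_ge0.
  have -> : (h + i).+1%:R = h%:R + (i%:R + 1) :> R by rewrite -natr1 natrD addrA.
  have id' : i%:R + 1 <= d%:R :> R by rewrite natr1 ler_nat.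
  have i1 : 0 <= i%:R :> R by [].
  rewrite mulrDr rh; have : r * (i%:R + 1) <= i%:R + 1 by rewrite ler_piMl//; lra.
  lra.
apply: le_trans (step d (leqnn d)); rewrite ler_wpM2l//.
have : expR (- (2 * (2 * d%:R / h%:R))) <= r.
  apply: expR_le_lin; apply/andP; split; first by rewrite divr_ge0// mulr_ge0.
  by rewrite ler_pdivrMr//; lra.
move=> /(@lerXn2r _ d _ _) h1; apply: le_trans (h1 _ _); rewrite ?nnegrE ?expR_ge0//.
by rewrite -expRM_natl ler_expR le_eqVlt; apply/orP; left; apply/eqP; field; rewrite gt_eqF.
Qed.

Lemma binom_weight_sym j (m : nat) : (m <= j)%N -> binom_weight j (Posz (j - m)) = binom_weight j (Posz m).
Proof. by move=> mj; rewrite !binom_weightE bin_sub. Qed.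

Lemma binom_weight_lower_even (h : nat) (z : int) (D : R) : (0 < h)%N -> 32 * D <= h%:R ->
  (z%:~R - h%:R) ^+ 2 <= 2 * D * h%:R ->
  expR (- (16 * D)) <= 4 * h%:R * binom_weight h.*2 z ^+ 2.
Proof.
move=> h0 hD zD.
have hr : 0 < h%:R :> R by rewrite ltr0n.
have zd : (`|z - Posz h|%N)%:R ^+ 2 = (z%:~R - h%:R) ^+ 2 :> R.
  by rewrite natr_absz intr_norm real_normK ?num_real// intrD mulrNz.
set d := `|z - Posz h|%N in zd.
have dh : (4 * d <= h)%N.
  rewrite -(ler_nat R) natrM -(@ler_pXn2r _ 2)// ?nnegrE ?mulr_ge0//.
  by rewrite exprMn zd; nra.
have bpz : binom_weight h.*2 z = binom_weight h.*2 (Posz (h + d)).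
  have [zh|zh] := leP (Posz h) z; first by congr (binom_weight _ _); rewrite /d; lia.
  rewrite -binom_weight_sym; last by lia.
  by congr (binom_weight _ _); rewrite /d; lia.
rewrite bpz binom_weightE.
have [_ /(_ h0)] := bin_center_sq h; rewrite natrM => h1.
have h2 := bin_center_lower h0 dh.
set P := 2 ^+ h.*2 in h1 *.
have P0 : 0 < P by rewrite exprn_gt0.
have e1 : expR (- (16 * D)) <= expR (- (4 * d%:R ^+ 2 / h%:R)) ^+ 2.
  rewrite -expRM_natl ler_expR.
  have -> : 2 * - (4 * d%:R ^+ 2 / h%:R) = - (8 * d%:R ^+ 2 / h%:R) :> R by ring.
  rewrite lerN2 ler_pdivrMr// zd; nra.
apply: le_trans e1 _; set e := expR _ in h2 *; have e0 : 0 < e by exact: expR_gt0.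
have h3 : ('C(h.*2, h)%:R * e) ^+ 2 <= 'C(h.*2, h + d)%:R ^+ 2 :> R.
  by rewrite ler_pXn2r// ?nnegrE// mulr_ge0// ltW.
rewrite expr_div_n mulrA ler_pdivlMr ?exprn_gt0//.
apply: (@le_trans _ _ (e ^+ 2 * (4 * h%:R * 'C(h.*2, h)%:R ^+ 2))).
  by rewrite ler_wpM2l// sqr_ge0.
have h4 : 0 <= 4 * h%:R :> R by rewrite mulr_ge0.
have := ler_wpM2l h4 h3; rewrite exprMn; lra.
Qed.

Lemma binom_weight_lower (D : R) j (z : int) : 0 <= D -> 64 * (3 * D + 1) + 3 <= j%:R ->
  (z%:~R - j%:R / 2) ^+ 2 <= D * j%:R ->
  expR (- (16 * (3 * D + 1))) / 8 <= j%:R * binom_weight j z ^+ 2.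
Proof.
move=> D0 jD zD; set D' := 3 * D + 1.
have jh := odd_double_half j; set h := j./2 in jh.
have jE : j%:R = (odd j)%:R + 2 * h%:R :> R by rewrite -[in LHS]jh natrD -mul2n natrM.
have o1 : 0 <= ((odd j)%:R : R) <= 1 by rewrite ler0n lern1 leq_b1.
case/andP: o1 => o0 o1.
have hr : 32 * D' <= h%:R by rewrite /D'; lra.
have h0 : (0 < h)%N by rewrite -(ltr_nat R); rewrite /D' in hr; lra.
have h1 : 1 <= h%:R :> R by rewrite ler1n.
have zh : (z%:~R - h%:R) ^+ 2 <= 2 * D' * h%:R.
  have -> : z%:~R - h%:R = (z%:~R - j%:R / 2) + (odd j)%:R / 2 :> R by rewrite jE; field.
  have ob : (odd j)%:R ^+ 2 <= 1 :> R by rewrite expr_le1.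
  set a := _ - j%:R / 2 in zD *; set o : R := (odd j)%:R in o0 o1 ob *.
  have := sqr_ge0 (a - o / 2).
  have Dh : D * j%:R <= 3 * D * h%:R by by nra.
  move: (h%:R) h1 Dh => y h1 Dh.
  move: zD ob; rewrite /D'; lra.
have := binom_weight_lower_even h0 hr zh; set e := expR _ => he.
have e0 : 0 < e by exact: expR_gt0.
have /andP[b0 _] := binom_weight01 h.*2 z; have /andP[b1 _] := binom_weight01 h.*2 (z - 1).
have hb := mulr_ge0 (ler0n R h) (sqr_ge0 (binom_weight h.*2 z)).
rewrite jE -{2}jh; case: (odd j) => /=.
  have := mulr_ge0 (ler0n R h) (sqr_ge0 (binom_weight h.*2 (z - 1))).
  have := mulr_ge0 (ler0n R h) (mulr_ge0 b0 b1).
  have := sqr_ge0 (binom_weight h.*2 z + binom_weight h.*2 (z - 1)).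
  lra.
by rewrite ?add0n add0r; lra.
Qed.

End binomial_weights.

(** * Local bounds for the free walk *)

Section local_bounds.
Context {R : realType}.
Variables (p : nat -> law R) (N : nat) (b : int) (eps V : R).
Hypotheses (eps0 : 0 < eps) (V0 : 0 <= V).
Hypothesis var_le : forall i, lvar (p i) <= V.
Hypothesis split_block : forall i f s, quad_growth f -> (forall z, 0 <= f z) ->
  eps * (f (s + b) + f (s + b + 1)) <= run p free i N f s.

Lemma run_free_shift i n f s c :
  run p free i n (fun z => f (z + c)) s = run p free i n f (s + c).
Proof.
elim: n i s => [//|n IH] i s; rewrite !run_freeS; apply: eq_E => k.
by rewrite IH addrAC.
Qed.

Lemma eps_le : eps <= 1 / 2.
Proof.
have := split_block 0 0 (quad_growth_cst 1) (fun=> ler01).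
by rewrite run_cst_free; lra.
Qed.

(** Removing the two atoms of a block leaves a positive functional. *)
Lemma split_le i f g s : quad_growth f -> quad_growth g -> (forall z, g z <= f z) ->
  run p free i N g s - eps * (g (s + b) + g (s + b + 1))
  <= run p free i N f s - eps * (f (s + b) + f (s + b + 1)).
Proof.
move=> qf qg gf.
have qN : quad_growth (fun z => -1 * g z) by exact: quad_growthZ.
have := split_block i s (quad_growthD qf qN).
rewrite runD// runZ// => h.
have fg z : 0 <= f z + -1 * g z by have := gf z; lra.
have := h fg; lra.
Qed.

(** The value to go when no block is left and j coins have been set aside. *)
Definition smooth j t : int -> R := fun s => binom_weight j (t - s).

Lemma smooth01 j t s : 0 <= smooth j t s <= 1.
Proof. exact: binom_weight01. Qed.

Lemma quad_growth_smooth j t : quad_growth (smooth j t).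
Proof. by apply: quad_growth01; exact: smooth01. Qed.

Lemma smooth0 t : smooth 0 t = delta t :> (int -> R).
Proof. by apply/funext => s; rewrite /smooth /delta /= subr_eq0 eq_sym. Qed.

Lemma smoothS i n j t s : run p free i n (smooth j.+1 t) s =
  (run p free i n (smooth j t) s + run p free i n (smooth j t) (s + 1)) / 2.
Proof.
have -> : smooth j.+1 t = fun z => 2^-1 * (smooth j t z + smooth j t (z + 1)).
  by apply/funext => z; rewrite /smooth /= opprD addrA mulrC.
rewrite runZ; last first.
  apply: quad_growthD; first exact: quad_growth_smooth.
  by apply: (@quad_growth01 _ _) => z; exact: smooth01.
rewrite runD; first by rewrite run_free_shift mulrC.
- exact: quad_growth_smooth.
- by apply: (@quad_growth01 _ _) => z; exact: smooth01.
Qed.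

Lemma run_block i r f : run p free i (r.+1 * N) f = run p free i N (run p free (i + N) (r * N) f).
Proof. by rewrite mulSn run_cat. Qed.

Lemma mean_sum_cat i m n : mean_sum p i (m + n) = mean_sum p i m + mean_sum p (i + m) n.
Proof. by rewrite /mean_sum addnA; apply: big_cat_nat; rewrite leq_addr. Qed.

Lemma var_sum_le i n : var_sum p i n <= n%:R * V.
Proof.
elim: n i => [|n IH] i; first by rewrite /var_sum addn0 big_geq// mul0r.
by rewrite var_sumS -natr1 mulrDl mul1r addrC lerD.
Qed.

(** Reading a block as either a coin, set aside in the counter j, or the rest of
    its law propagates a lower bound backwards through the blocks.  Since the
    bound is quadratic in (j, s), only the means and variances of j and of the
    position enter: j grows by 2 eps per block in mean, and setting a coin
    aside replaces its value by its mean 1 / 2, which lowers the mean square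
    of the distance to t. *)
Lemma local_lower_aux (c0 al ga js : R) (t : int) : 0 <= c0 -> 0 <= al -> 0 <= ga ->
  (forall j s, c0 * (1 - al * (j%:R - js) ^+ 2
      - ga * (t%:~R - s%:~R - j%:R / 2) ^+ 2) <= smooth j t s) ->
  forall r i j s,
   c0 * (1 - al * ((j%:R + 2 * eps * r%:R - js) ^+ 2 + r%:R)
     - ga * ((t%:~R - s%:~R - j%:R / 2 - mean_sum p i (r * N)) ^+ 2 + r%:R * N%:R * V))
   <= run p free i (r * N) (smooth j t) s.
Proof.
move=> c00 al0 ga0 base; elim=> [|r IH] i j s.
  by rewrite mul0n /mean_sum addn0 big_geq//= !mulr0 !mul0r !addr0 !subr0; exact: base.
move: (eps0) (eps_le) (V0) => e0 e1 v0.
set a := j%:R + 2 * eps * r%:R - js.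
set d := t%:~R - j%:R / 2 - mean_sum p (i + N) (r * N).
pose K := c0 * (1 - al * (a ^+ 2 + r%:R) - ga * (r%:R * N%:R * V)).
pose g z := K + (- (c0 * ga)) * (d - z%:~R) ^+ 2.
set f := run p free (i + N) (r * N) (smooth j t).
have qf : quad_growth f by apply: quad_growth_run; exact: quad_growth_smooth.
have qg : quad_growth g.
  by apply: quad_growthD; [exact: quad_growth_cst|exact/quad_growthZ/quad_growth_sq].
have gf z : g z <= f z.
  apply: le_trans (IH (i + N)%N j z); rewrite le_eqVlt; apply/orP; left; apply/eqP.
  by rewrite /g /K /d /a; ring.
have := split_le i s qf qg gf; rewrite run_block -/f.
have -> : run p free i N g s = K - c0 * ga * ((d - s%:~R - mean_sum p i N) ^+ 2 + var_sum p i N).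
  rewrite runD; [|exact: quad_growth_cst|exact/quad_growthZ/quad_growth_sq].
  by rewrite run_cst_free runZ ?run_free_sq ?mulNr//; exact: quad_growth_sq.
have := IH (i + N)%N j.+1 (s + b); rewrite smoothS -/f.
have vs := var_sum_le i N.
have -> : mean_sum p i (r.+1 * N) = mean_sum p i N + mean_sum p (i + N) (r * N).
  by rewrite mulSn mean_sum_cat.
rewrite -(natr1 r) -(natr1 j) /g !intrD.
have cg := mulr_ge0 c00 ga0; have ca := mulr_ge0 c00 al0.
have h1 := ler_wpM2l cg vs.
have h2 : c0 * al * (2 * eps) <= c0 * al * (4 * eps ^+ 2 + 1) by rewrite ler_wpM2l//; nra.
have h3 : 0 <= eps * (c0 * ga) by rewrite mulr_ge0// ltW.
set F0 := f _; set F1 := f _; set F2 := run _ _ _ _ _ _.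
move=> H1 H2.
have H3 := ler_wpM2l (_ : 0 <= 2 * eps) H1.
have {}H3 := H3 ltac:(lra).
have : 2 * eps * ((F0 + F1) / 2) = eps * (F0 + F1) by field.
move=> E1; rewrite E1 in H3.
have H4 := lerD H2 H3.
have E2 : F2 - eps * (F0 + F1) + eps * (F0 + F1) = F2 by ring.
rewrite E2 in H4; apply: le_trans H4.
rewrite /K /d -/a.
have -> : j%:R + 1 + 2 * eps * r%:R - js = a + 1 by rewrite /a; ring.
have -> : j%:R + 2 * eps * (r%:R + 1) - js = a + 2 * eps by rewrite /a; ring.
nra.
Qed.

Lemma local_upper_aux (c1 al js : R) (t : int) : 0 <= al ->
  (forall j s, smooth j t s <= c1 + al * (j%:R - js) ^+ 2) ->
  forall r i j s, run p free i (r * N) (smooth j t) s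
   <= c1 + al * ((j%:R + 2 * eps * r%:R - js) ^+ 2 + r%:R).
Proof.
move=> al0 base; elim=> [|r IH] i j s.
  by rewrite mul0n /= !mulr0 !addr0; exact: base.
move: (eps0) eps_le => e0 e1.
set a := j%:R + 2 * eps * r%:R - js.
set f := run p free (i + N) (r * N) (smooth j t).
have qf : quad_growth f by apply: quad_growth_run; exact: quad_growth_smooth.
set K := c1 + al * (a ^+ 2 + r%:R).
have fK z : f z <= K by exact: IH.
have := split_le i s (quad_growth_cst K) qf fK; rewrite run_block -/f run_cst_free.
have := IH (i + N)%N j.+1 (s + b); rewrite smoothS -/f.
rewrite -(natr1 r) -(natr1 j).
set F0 := f _; set F1 := f _; set F2 := run _ _ _ _ _ _.
move=> H1 H2.
have H3 := ler_wpM2l (_ : 0 <= 2 * eps) H1.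
have {}H3 := H3 ltac:(lra).
have h2 : al * (2 * eps) <= al * (4 * eps ^+ 2 + 1) by rewrite ler_wpM2l//; nra.
have E3 : j%:R + 1 + 2 * eps * r%:R - js = a + 1 by rewrite /a; ring.
have -> : j%:R + 2 * eps * (r%:R + 1) - js = a + 2 * eps by rewrite /a; ring.
rewrite E3 in H3; rewrite /K in H2.
nra.
Qed.

(** About 2 eps M of the M blocks are coins, and at least eps M of them up to an
    event of probability of order 1 / (eps ^ 2 M); these constants collect what
    the bounds on binomial weights then give. *)
Definition up_const : R := (Num.sqrt eps)^-1 + (eps ^+ 2)^-1.
Definition spread : R := 4 * (1 + V * N%:R).
Definition low_const : R :=
  Num.sqrt (expR (- (16 * (3 * (spread / eps) + 1))) / 8 / (3 * eps)) / 2.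

Lemma up_const_gt0 : 0 < up_const.
Proof. by rewrite /up_const addr_gt0 ?invr_gt0 ?sqrtr_gt0 ?exprn_gt0. Qed.

Lemma low_const_gt0 : 0 < low_const.
Proof.
by rewrite /low_const divr_gt0// sqrtr_gt0 !divr_gt0 ?mulr_gt0 ?expR_gt0.
Qed.

Lemma spread_ge1 : 4 <= spread.
Proof. by rewrite /spread -[leLHS]mulr1 ler_wpM2l// lerDl mulr_ge0. Qed.

Lemma local_upper i M t s : (0 < M)%N ->
  run p free i (M * N) (delta t) s <= up_const / Num.sqrt M%:R.
Proof.
move=> M0; move: (eps0) => e0.
have m0 : 0 < M%:R :> R by rewrite ltr0n.
have m1 : 1 <= M%:R :> R by rewrite ler1n.
have em0 : 0 < eps * M%:R by rewrite mulr_gt0.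
set js := 2 * eps * M%:R; set al := ((eps * M%:R) ^+ 2)^-1.
have al0 : 0 <= al by rewrite invr_ge0 sqr_ge0.
set c1 := (Num.sqrt (eps * M%:R))^-1.
have c10 : 0 < c1 by rewrite invr_gt0 sqrtr_gt0.
have base j z : smooth j t z <= c1 + al * (j%:R - js) ^+ 2.
  have /andP[s0 s1] := smooth01 j t z.
  have [jM|jM] := leP j%:R (eps * M%:R).
    apply: (le_trans s1); have : 1 <= al * (j%:R - js) ^+ 2.
      rewrite mulrC ler_pdivlMr ?exprn_gt0// mul1r -[leRHS]sqrrN.
      by rewrite ler_pXn2r// ?nnegrE /js; lra.
    lra.
  have j0 : 0 < j%:R :> R by exact: lt_trans jM.
  have h : smooth j t z <= c1.
    rewrite /c1 -(@ler_pXn2r _ 2)// ?nnegrE ?(ltW c10)// exprVn sqr_sqrtr ?(ltW em0)//.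
    have := binom_weight_upper (R := R) j (t - z); rewrite -/(smooth j t z) => hb.
    rewrite -[leRHS]mul1r ler_pdivlMr//; apply: le_trans hb.
    by rewrite mulrC ler_wpM2r ?sqr_ge0// ltW.
  by have := mulr_ge0 al0 (sqr_ge0 (j%:R - js)); lra.
have := local_upper_aux al0 base M i 0 s; rewrite smooth0 => h; apply: le_trans h _.
have -> : 0%:R + 2 * eps * M%:R - js = 0 by rewrite /js; ring.
rewrite expr0n add0r /up_const mulrDl /c1 sqrtrM ?(ltW e0)// invfM lerD2l.
have sm : 0 < Num.sqrt M%:R :> R by rewrite sqrtr_gt0.
have sm2 : Num.sqrt M%:R ^+ 2 = M%:R :> R by rewrite sqr_sqrtr// ltW.
rewrite /al exprMn invfM -mulrA ler_wpM2l ?invr_ge0 ?sqr_ge0//.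
rewrite expr2 invfM -mulrA mulVf ?gt_eqF// mulr1.
rewrite lef_pV2 ?posrE// -[leRHS]sm2.
have : 1 <= Num.sqrt M%:R :> R by rewrite -(@ler_pXn2r _ 2)// ?nnegrE ?sqrtr_ge0// expr1n sm2.
nra.
Qed.

Lemma local_lower i M t s : (0 < M)%N ->
  64 * (3 * (spread / eps) + 1) + 3 <= eps * M%:R -> 4 <= eps ^+ 2 * M%:R ->
  (t%:~R - s%:~R - mean_sum p i (M * N)) ^+ 2 <= M%:R ->
  low_const / Num.sqrt M%:R <= run p free i (M * N) (delta t) s.
Proof.
move=> M0 Mb M4 near; move: (eps0) (V0) spread_ge1 => e0 v0 sp.
have m0 : 0 < M%:R :> R by rewrite ltr0n.
have em0 : 0 < eps * M%:R by rewrite mulr_gt0.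
have sp0 : 0 < spread by lra.
set js := 2 * eps * M%:R; set al := ((eps * M%:R) ^+ 2)^-1.
have al0 : 0 < al by rewrite invr_gt0 exprn_gt0.
set ga := (spread * M%:R)^-1.
have ga0 : 0 < ga by rewrite invr_gt0 mulr_gt0.
pose cc := expR (- (16 * (3 * (spread / eps) + 1))) / 8.
have cc0 : 0 < cc by rewrite divr_gt0 ?expR_gt0.
pose c0 := Num.sqrt (cc / (3 * (eps * M%:R))).
have c00 : 0 < c0 by rewrite sqrtr_gt0 divr_gt0// mulr_gt0.
have base j z : c0 * (1 - al * (j%:R - js) ^+ 2
      - ga * (t%:~R - z%:~R - j%:R / 2) ^+ 2) <= smooth j t z.
  have /andP[s0 s1] := smooth01 j t z.
  set q1 := (j%:R - js) ^+ 2; set q2 := (_ - j%:R / 2) ^+ 2.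
  have p1 : 0 <= al * q1 by rewrite mulr_ge0 ?sqr_ge0// ltW.
  have p2 : 0 <= ga * q2 by rewrite mulr_ge0 ?sqr_ge0// ltW.
  have [jj|jj] := leP 1 (al * q1).
    by apply: le_trans s0; rewrite pmulr_rle0//; lra.
  have [zz|zz] := leP 1 (ga * q2).
    by apply: le_trans s0; rewrite pmulr_rle0//; lra.
  apply: (@le_trans _ _ c0); first by rewrite ler_piMr ?(ltW c00)//; lra.
  have {}jj : q1 < (eps * M%:R) ^+ 2.
    by move: jj; rewrite /al mulrC ltr_pdivrMr ?exprn_gt0// mul1r.
  have {}zz : q2 < spread * M%:R.
    by move: zz; rewrite /ga mulrC ltr_pdivrMr ?mul1r//; exact: mulr_gt0.
  have /andP[j1 j2] : eps * M%:R < j%:R < 3 * (eps * M%:R).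
    have : `|j%:R - js| < eps * M%:R.
      rewrite -(@ltr_pXn2r _ 2)// ?nnegrE ?(ltW em0)//.
      by rewrite real_normK ?num_real.
    by rewrite ltr_norml /js => /andP[? ?]; apply/andP; split; lra.
  have D0 : 0 <= spread / eps by rewrite divr_ge0 ?ltW.
  have zj : ((t - z)%:~R - j%:R / 2) ^+ 2 <= spread / eps * j%:R.
    rewrite intrD mulrNz; apply: le_trans (ltW zz) _.
    by rewrite -mulrA ler_pM2l// mulrC ler_pdivlMr// mulrC ltW.
  have := binom_weight_lower D0 (_ : _ <= j%:R) zj.
  move=> /(_ ltac:(lra)); rewrite -/(smooth j t z) -/cc => hb.
  rewrite /c0 -(@ler_pXn2r _ 2)// ?nnegrE ?(ltW c00)//.
  rewrite sqr_sqrtr ?divr_ge0 ?mulr_ge0 ?(ltW cc0) ?(ltW e0)//.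
  rewrite ler_pdivrMr ?mulr_gt0//; apply: le_trans hb _.
  by rewrite mulrC ler_wpM2l ?sqr_ge0// ltW.
have := local_lower_aux (ltW c00) (ltW al0) (ltW ga0) base M i 0 s.
rewrite smooth0; apply: le_trans.
have -> : 0%:R + 2 * eps * M%:R - js = 0 by rewrite /js; ring.
rewrite expr0n add0r mul0r subr0.
have -> : low_const / Num.sqrt M%:R = c0 * 2^-1.
  rewrite /low_const /c0 -/cc.
  have -> : cc / (3 * (eps * M%:R)) = cc / (3 * eps) * M%:R^-1.
    by rewrite mulrA invfM mulrA.
  rewrite [in RHS]sqrtrM ?divr_ge0 ?mulr_ge0 ?(ltW cc0) ?(ltW e0)// sqrtrV ?(ltW m0)//.
  by rewrite mulrAC.
rewrite ler_pM2l//.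
have h1 : al * M%:R <= 1 / 4.
  rewrite /al mulrC ler_pdivrMr ?exprn_gt0//.
  have := ler_wpM2r (ltW m0) M4; rewrite exprMn; lra.
have h2 : ga * ((t%:~R - s%:~R - mean_sum p i (M * N)) ^+ 2 + M%:R * N%:R * V) <= 1 / 4.
  rewrite /ga mulrC ler_pdivrMr; last exact: mulr_gt0.
  have -> : 1 / 4 * (spread * M%:R) = M%:R + M%:R * N%:R * V by rewrite /spread; field.
  by rewrite lerD2r.
lra.
Qed.

End local_bounds.

(** * Local lower bound for the confined walk *)

Section middle.
Context {R : realType}.
Variables (p : nat -> law R) (x0 lam : R) (N : nat) (b : int) (eps V : R).
Hypotheses (lam0 : 0 < lam) (eps0 : 0 < eps) (V0 : 0 <= V).
Hypothesis var_le : forall i, lvar (p i) <= V.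
Hypothesis split_block : forall i f s, quad_growth f -> (forall z, 0 <= f z) ->
  eps * (f (s + b) + f (s + b + 1)) <= run p free i N f s.

Local Notation win := (win p x0 lam).
Local Notation cpos := (cpos p x0).
Local Notation one := (fun=> 1 : R).

(** Chebyshev bound on the probability to stay in the window for n steps from x.
    It is nonpositive outside the window and affine in the second moment. *)
Let stay_bound n (x : R) := 1 - (x ^+ 2 + n%:R * V) / (lam / 2) ^+ 2.

Lemma quad_growth_stay_bound n (e : bool) (q : law R) (x : R) :
  quad_growth (fun k => stay_bound n (x + centred e q k)).
Proof.
have qc := quad_growth_centred e q; rewrite /stay_bound.
set L := (lam / 2) ^+ 2.
have -> : (fun k => 1 - ((x + centred e q k) ^+ 2 + n%:R * V) / L) =
  (fun k => (1 - (x ^+ 2 + n%:R * V) / L) + ((- 2 * x / L) * centred e q k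
      + (- L^-1) * (k%:~R - lmean q) ^+ 2)).
  by apply/funext => k; rewrite -(centred_sq e); ring.
apply: quad_growthD; first exact: quad_growth_cst.
by apply: quad_growthD; apply: quad_growthZ => //; exact: quad_growth_centred_sq.
Qed.

Lemma stay_bound_step n e (q : law R) x : lvar q <= V ->
  stay_bound n.+1 x <= E q (fun k => stay_bound n (x + centred e q k)).
Proof.
move=> qV; rewrite /stay_bound; set L := (lam / 2) ^+ 2.
have L0 : 0 < L by rewrite exprn_gt0// divr_gt0.
rewrite (eq_E q (g := fun k => (1 - (x ^+ 2 + n%:R * V) / L) + (- 2 * x / L) * centred e q k
   + (- L^-1) * centred e q k ^+ 2 + 0 * (centred e q k ^+ 2 * near_mean 0 q k))); last first.
  by move=> k; ring.
rewrite E_centred_quad mul0r addr0 -natr1.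
have := ler_wpM2r (_ : 0 <= L^-1) qV; rewrite invr_ge0 => /(_ (ltW L0)).
lra.
Qed.

Lemma stay_bound_outside n j s : ~~ win j s -> stay_bound n (cpos j s) <= 0.
Proof.
move=> h; have v0 := V0; have L0 : 0 < (lam / 2) ^+ 2 by rewrite exprn_gt0// divr_gt0.
rewrite /stay_bound subr_le0 ler_pdivlMr// mul1r.
have nV : 0 <= n%:R * V by rewrite mulr_ge0.
suff : (lam / 2) ^+ 2 <= cpos j s ^+ 2 by lra.
rewrite -[leRHS]real_normK ?num_real// ler_pXn2r// ?nnegrE ?divr_ge0 ?(ltW lam0)//.
by move: h; rewrite /win -ltNge => /ltW.
Qed.

Lemma stay_bound_le1 n x : stay_bound n x <= 1.
Proof.
have v0 := V0; rewrite /stay_bound gerBl divr_ge0 ?sqr_ge0// addr_ge0 ?sqr_ge0//.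
by rewrite mulr_ge0.
Qed.

Lemma run_stay n i s : stay_bound n (cpos i s) <= run p win i n one s.
Proof.
elim: n i s => [|n IH] i s; first exact: stay_bound_le1.
apply: le_trans (stay_bound_step n false (cpos i s) (var_le i)) _.
have qf : quad_growth (fun s => (win i.+1 s)%:R * run p win i.+1 n one s).
  by apply: quad_growth_kill; apply: quad_growth_run; exact: quad_growth_cst.
apply: E_le => [||k]; first exact: quad_growth_stay_bound.
  exact: (quad_growth_comp false s qf).
rewrite -cpos_shift /=; have [hw|hw] := boolP (win i.+1 (s + k)).
  by rewrite mul1r; exact: IH.
by rewrite mul0r; exact: stay_bound_outside.
Qed.

Lemma corun_stay n i s :
  stay_bound n (cpos (i + n) s) <= corun p win i n (fun z => (win i z)%:R) s.
Proof.
elim: n s => [|n IH] s.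
  rewrite addn0 /=; have [hw|hw] := boolP (win i s); first exact: stay_bound_le1.
  exact: stay_bound_outside.
rewrite /=; have [hw|hw] := boolP (win (i + n.+1) s); last first.
  by rewrite mul0r; exact: stay_bound_outside.
rewrite mul1r addnS.
apply: le_trans (stay_bound_step n true (cpos (i + n).+1 s) (var_le (i + n))) _.
set f := corun _ _ _ _ _.
have qf : quad_growth f.
  apply: quad_growth_corun; apply: quad_growth01 => z.
  by rewrite ler0n lern1 leq_b1.
apply: E_le => [||k]; first exact: quad_growth_stay_bound.
  exact: (quad_growth_comp true s qf).
by rewrite -cpos_coshift; exact: IH.
Qed.

Lemma cposB i n s t : t%:~R - s%:~R - mean_sum p i n = cpos (i + n) t - cpos i s.
Proof. by rewrite /cpos mean_sum_cat add0n; ring. Qed.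

(** Keeps the probability to leave the window below low_const / (6 up_const), so
    that the two halves together lose at most a third of low_const. *)
Definition stay_const : R := low_const N eps V / (6 * up_const eps).

(** The free walk joins s to z with probability of order 1 / sqrt H.  A path
    leaving the window in the first half still has to hit z in the second half,
    which costs a factor 1 / sqrt H by the upper bound; for a path leaving in
    the second half, exchange the roles of the halves by reversing time. *)
Lemma middle_lower i H s z (F : seq int) : uniq F ->
  (forall j y, (i < j <= i + (H * N + H * N))%N -> win j y -> y \in F) ->
  (0 < H)%N -> (0 < N)%N ->
  64 * (3 * (spread N V / eps) + 1) + 3 <= eps * (2 * H%:R) ->
  4 <= eps ^+ 2 * (2 * H%:R) ->
  2 * H%:R <= lam ^+ 2 -> H%:R * (2 + 4 * N%:R * V) <= stay_const * lam ^+ 2 ->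
  2 * cpos i s ^+ 2 <= H%:R ->
  2 * cpos (i + (H * N + H * N)) z ^+ 2 <= H%:R ->
  low_const N eps V / (4 * Num.sqrt H%:R)
    <= run p win i (H * N + H * N) (delta z) s.
Proof.
move=> uF wF H0 N0 Hb H4 HL Hs xs xz.
set nh := (H * N)%N in wF xz *.
have nh0 : (0 < nh)%N by rewrite muln_gt0 H0.
have h0 : 0 < H%:R :> R by rewrite ltr0n.
set rH := Num.sqrt H%:R.
have rH0 : 0 < rH by rewrite sqrtr_gt0.
have lo0 := low_const_gt0 N V eps0; have up0 := up_const_gt0 eps0.
set lo := low_const N eps V in lo0 *; set up := up_const eps in up0.
set g := run p win (i + nh) nh (delta z).
set g' := run p free (i + nh) nh (delta z).
have dz0 y : 0 <= delta z y :> R by have /andP[] := @delta01 R z y.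
have qd : quad_growth (delta z : int -> R) by exact: quad_growth_delta.
have qg : quad_growth g by exact: quad_growth_run.
have qg' : quad_growth g' by exact: quad_growth_run.
have g0 y : 0 <= g y by exact: run_ge0.
have gg' y : g y <= g' y by exact: run_le_free.
have free_up j x y : run p free j nh (delta x) y <= up / rH.
  exact: (local_upper eps0 split_block).
have g'up y : g' y <= up / rH by exact: free_up.
set dl := H%:R * (2 + 4 * N%:R * V) / lam ^+ 2.
have l20 : 0 < lam ^+ 2 by rewrite exprn_gt0.
have dl1 : dl <= lo / (6 * up) by rewrite ler_pdivrMr.
have leaveE x : 2 * x ^+ 2 <= H%:R -> 1 - dl <= stay_bound nh x.
  move=> hx; rewrite /stay_bound /dl lerB// /nh natrM.
  have -> : (x ^+ 2 + H%:R * N%:R * V) / (lam / 2) ^+ 2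
     = (4 * x ^+ 2 + 4 * (H%:R * N%:R * V)) / lam ^+ 2 by field; rewrite gt_eqF.
  by rewrite ler_pM2r ?invr_gt0//; lra.
(* g' is at most up / rH everywhere, so the paths killed in the first half count
   for at most up / rH times their probability *)
have first_half : run p free i nh g' s - run p win i nh g' s <= up / rH * dl.
  pose c := up / rH.
  have qc : quad_growth (fun y => c + -1 * g' y).
    by apply: quad_growthD; [exact: quad_growth_cst|exact: quad_growthZ].
  have := @run_le_free R p win i nh _ qc.
  have c0 y : 0 <= c + -1 * g' y by have := g'up y; rewrite -/c; lra.
  move=> /(_ c0 s).
  have cE : (fun=> c) = (fun y => c * one y) :> (int -> R).
    by apply/funext => y; rewrite mulr1.
  rewrite !runD// ?(runZ p win i nh (-1) qg') ?(runZ p free i nh (-1) qg');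
    try (first [exact: quad_growth_cst | exact: quad_growthZ]).
  rewrite run_cst_free cE runZ; last exact: quad_growth_cst.
  have := run_stay nh i s; have := leaveE _ xs.
  have cc0 : 0 <= c by rewrite /c divr_ge0// ltW.
  move=> h1 h2; have := ler_wpM2l cc0 (le_trans h1 h2).
  rewrite -/c; lra.
have zwin : win (i + (nh + nh)) z.
  rewrite /win -(@ler_pXn2r _ 2)// ?nnegrE ?divr_ge0 ?(ltW lam0)//.
  rewrite real_normK ?num_real//.
  have -> : (lam / 2) ^+ 2 = lam ^+ 2 / 4 by field.
  lra.
have inh : (i < i + nh <= i + (nh + nh))%N.
  by rewrite -[ltnLHS]addn0 ltn_add2l nh0 leq_add2l leq_addr.
set F' := [seq y <- F | win (i + nh)%N y].
have uF' : uniq F' by rewrite filter_uniq.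
have zF : z \in F by apply: wF zwin; rewrite leqnn andbT -[ltnLHS]addn0 ltn_add2l addn_gt0 nh0.
have wF2 j y : (i + nh < j <= i + nh + nh)%N -> win j y -> y \in F.
  by move=> /andP[ij jn]; apply: wF; rewrite (leq_ltn_trans _ ij) ?leq_addr//= addnA.
have second_sum : \sum_(y <- F') (g' y - g y) <= dl.
  rewrite sumrB.
  have s1 : \sum_(y <- F') g' y <= 1 by exact: sum_free_delta_le1.
  have s2 : 1 - dl <= \sum_(y <- F') g y.
    have -> : \sum_(y <- F') g y = \sum_(y <- F) (win (i + nh)%N y)%:R * g y.
      rewrite /F' big_filter big_mkcond; apply: eq_bigr => y _.
      by case: (win _ _); rewrite ?mul1r ?mul0r.
    rewrite (corun_delta _ uF wF2 _ zF); last first.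
      move=> y; have [wy _|] := boolP (win (i + nh)%N y); last by rewrite eqxx.
      exact: wF wy.
    apply: le_trans (corun_stay nh (i + nh) z).
    by apply: leaveE; rewrite -addnA.
  lra.
have second_half : run p win i nh (fun y => g' y + -1 * g y) s <= up / rH * dl.
  have qgg : quad_growth (fun y => g' y + -1 * g y).
    by apply: quad_growthD => //; exact: quad_growthZ.
  have winF' y : win (i + nh.-1.+1)%N y -> y \in F'.
    rewrite prednK// => wy; rewrite mem_filter wy; exact: wF wy.
  have := run_window p s uF' winF' qgg; rewrite prednK// => ->.
  have upr0 : 0 <= up / rH by rewrite divr_ge0// ltW.
  apply: le_trans (ler_wpM2l upr0 second_sum).
  rewrite mulr_sumr; apply: ler_sum => y _.
  rewrite mulN1r mulrC ler_wpM2r ?subr_ge0//.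
  apply: (@le_trans _ _ (run p free i nh (delta y) s)); last exact: free_up.
  apply: run_le_free; first exact: quad_growth_delta.
  by move=> x; have /andP[] := @delta01 R y x.
have total : lo / Num.sqrt (H + H)%:R <= run p free i nh g' s.
  rewrite /g' -run_cat /nh -mulnDl; apply: (local_lower eps0 V0 var_le split_block) => //.
  - by rewrite addn_gt0 H0.
  - by rewrite natrD; lra.
  - by rewrite natrD; lra.
  - rewrite mulnDl cposB natrD.
    have := sqr_ge0 (cpos (i + (H * N + H * N)) z + cpos i s).
    rewrite /nh in xz; lra.
have sq2 : Num.sqrt (H + H)%:R <= 3 / 2 * rH.
  rewrite -(@ler_pXn2r _ 2)// ?nnegrE ?sqrtr_ge0 ?mulr_ge0 ?(ltW rH0)//.
  rewrite exprMn !sqr_sqrtr ?ler0n// natrD; lra.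
have lo2 : lo / (3 / 2 * rH) <= lo / Num.sqrt (H + H)%:R.
  rewrite ler_pM2l// lef_pV2 ?posrE ?mulr_gt0// sqrtr_gt0 ltr0n addn_gt0 H0//.
rewrite run_cat -/g.
rewrite runD ?runZ// in second_half; last exact: quad_growthZ.
have e1 : up / rH * dl <= lo / (6 * rH).
  have -> : lo / (6 * rH) = up / rH * (lo / (6 * up)) by field; rewrite !gt_eqF.
  by rewrite ler_wpM2l// divr_ge0// ltW.
have E1 : lo / (3 / 2 * rH) = 2 / 3 * (lo / rH) by field; rewrite gt_eqF.
have E2 : lo / (6 * rH) = 1 / 6 * (lo / rH) by field; rewrite gt_eqF.
have E3 : lo / (4 * rH) = 1 / 4 * (lo / rH) by field; rewrite gt_eqF.
have lr : 0 <= lo / rH by rewrite divr_ge0// ltW.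
rewrite E1 in lo2; rewrite E2 in e1; rewrite E3; lra.
Qed.

End middle.

(** * Words over the support *)

Section support_words.
Context {R : realType}.
Variable a : int -> R.
Hypothesis a_irr : irreducible_aperiodic_seq a.

Definition word_sum (k : seq int) : int := \sum_(i <- k) i.
Definition word_in_support (k : seq int) : bool := all (fun i => 0 < a i) k.

Lemma walk_word (q : probability int R) n x y :
  (forall i, (0 < q [set i])%E -> 0 < a i) ->
  (0 < walk_prob q n x y)%E -> exists k, [/\ size k = n, word_in_support k & y = x + word_sum k].
Proof.
move=> qa.
have ge0 m u v : (0 <= walk_prob q m u v)%E.
  elim: m u => [|m IHm] u /=; first by case: ifP.
  by apply: esum_ge0 => z _; rewrite mule_ge0.
elim: n x => [|n IH] x /=.
  case: eqP => [<- _|]; last by rewrite ltxx.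
  by exists [::]; split => //; rewrite /word_sum big_nil addr0.
move=> h.
have [z hz] : exists z : int, (0 < q [set (z - x)%R] * walk_prob q n z y)%E.
  apply: contrapT => hn; move: h; rewrite esum1 ?ltxx// => z _.
  apply/eqP; rewrite eq_le; apply/andP; split; last by rewrite mule_ge0.
  by rewrite leNgt; apply/negP => hz; apply: hn; exists z.
have qz : (0 < q [set (z - x)%R])%E.
  rewrite lt_neqAle measure_ge0 andbT; apply/negP => /eqP q0.
  by move: hz; rewrite -q0 mul0e ltxx.
have wz : (0 < walk_prob q n z y)%E.
  rewrite lt_neqAle ge0 andbT; apply/negP => /eqP q0.
  by move: hz; rewrite -q0 mule0 ltxx.
have [k [sk pk ek]] := IH z wz.
exists (z - x :: k); split => /=; first by rewrite sk.
  by rewrite /word_in_support /= qa.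
by rewrite ek /word_sum big_cons addrA [x + _]addrC subrK.
Qed.

(** The values x by which words of equal length may differ.  They form a subgroup
    of the integers, because words can be concatenated and exchanged. *)
Definition word_diff (x : int) : Prop := exists k k' : seq int,
  [/\ size k = size k', word_in_support k, word_in_support k' & word_sum k' = word_sum k + x].

Lemma word_sum_cat k l : word_sum (k ++ l) = word_sum k + word_sum l.
Proof. exact: big_cat. Qed.

Lemma word_sum_nseq n i : word_sum (nseq n i) = i *+ n.
Proof. by rewrite /word_sum big_nseq -Monoid.iteropE. Qed.

Lemma word_diff0 : word_diff 0.
Proof. by exists [::], [::]; split => //; rewrite addr0. Qed.

Lemma word_diffD x y : word_diff x -> word_diff y -> word_diff (x + y).
Proof.
move=> [k [k' [s1 p1 p1' e1]]] [l [l' [s2 p2 p2' e2]]].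
exists (k ++ l), (k' ++ l'); split.
- by rewrite !size_cat s1 s2.
- by rewrite /word_in_support all_cat; apply/andP.
- by rewrite /word_in_support all_cat; apply/andP.
- by rewrite !word_sum_cat e1 e2; ring.
Qed.

Lemma word_diffN x : word_diff x -> word_diff (- x).
Proof.
by move=> [k [k' [s1 p1 p1' e1]]]; exists k', k; split => //; rewrite e1 addrK.
Qed.

Lemma word_diffMz x m : word_diff x -> word_diff (x * m).
Proof.
move=> dx; have nat_case (n : nat) : word_diff (x * n%:Z).
  elim: n => [|n IH]; first by rewrite mulr0; exact: word_diff0.
  by rewrite intS mulrDr mulr1; exact: word_diffD.
case: m => n; first exact: nat_case.
by rewrite NegzE mulrN; apply: word_diffN; exact: nat_case.
Qed.

Lemma word_diff_word i k : 0 < a i -> word_in_support k -> word_diff (word_sum k - i *+ size k).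
Proof.
move=> ai pk; exists (nseq (size k) i), k; split => //.
- by rewrite size_nseq.
- by rewrite /word_in_support all_nseq ai orbT.
- by rewrite word_sum_nseq addrC subrK.
Qed.

(** The subgroup is generated by some d, so all points of the support are congruent
    to one of them, say i0, modulo d.  A word with sum 1 shows that i0 is
    invertible modulo d, and a loop of length n gives d | n i0, hence d | n; so
    d divides all return times and is 1.  The subgroup is not trivial, since a
    support reduced to i0 would not allow sums of both signs. *)
Lemma word_diff_unit : word_diff 1.
Proof.
case: a_irr => q [c [irr aper c0 ac]].
have qa i : (0 < q [set i])%E -> 0 < a i.
  by move=> h; rewrite -lte_fin ac mule_gt0// lte_fin c0.
have word x : exists k, word_in_support k /\ word_sum k = x.
  have [n hn] := irr 0 x.
  by have [k [_ pk ->]] := walk_word qa hn; exists k; rewrite add0r.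
have [k1 [pk1 sk1]] := word 1; have [k2 [pk2 sk2]] := word (-1).
have [i0 ai0] : exists i, 0 < a i.
  case: k1 pk1 sk1 => [|i k1]; first by rewrite /word_sum big_nil.
  by move=> /andP[ai _] _; exists i.
pose P n := `[< word_diff n%:Z >] && (0 < n)%N.
have [hP|hP] := pselect (exists n, P n); last first.
  have D0 x : word_diff x -> x = 0.
    case: x => [[//|n]|n] dx.
      by exfalso; apply: hP; exists n.+1; rewrite /P andbT; apply/asboolP.
    exfalso; apply: hP; exists n.+1; rewrite /P andbT; apply/asboolP.
    by have := word_diffN dx; rewrite NegzE opprK.
  have e1 : 1 = i0 *+ size k1.
    by apply/eqP; rewrite -subr_eq0 -sk1; apply/eqP/D0; exact: word_diff_word.
  have e2 : -1 = i0 *+ size k2.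
    by apply/eqP; rewrite -subr_eq0 -sk2; apply/eqP/D0; exact: word_diff_word.
  exfalso; have [h|h] := leP 0 i0.
    have := mulrn_wge0 (size k2) h; by rewrite -e2.
  have := mulrn_wle0 (size k1) (ltW h); by rewrite -e1.
case: (ex_minnP hP) => d /andP[/asboolP dd d0] dmin.
have dvd x : word_diff x -> (d%:Z %| x)%Z.
  move=> dx; apply/dvdz_mod0P; have dz : d%:Z != 0 by rewrite -lt0n in d0 *; lia.
  have m0 : 0 <= (x %% d%:Z)%Z by exact: modz_ge0.
  have md : (x %% d%:Z)%Z < d%:Z by rewrite ltz_pmod.
  have wm : word_diff (x %% d%:Z)%Z.
    have -> : (x %% d%:Z)%Z = x + d%:Z * (- (x %/ d%:Z)%Z).
      by rewrite {2}(divz_eq x d%:Z); ring.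
    by apply: word_diffD => //; exact: word_diffMz.
  move: m0 md wm; case: (x %% d%:Z)%Z => [[//|n]|//] _ nd wn.
  have : (d <= n.+1)%N by apply: dmin; rewrite /P andbT; apply/asboolP.
  by move: nd; rewrite ltz_nat => nd; rewrite leqNgt nd.
suff d1 : d = 1%N by rewrite d1 in dd.
apply: (aper 0 d) => n n0 hn.
have [k [sk pk ek]] := walk_word qa hn.
have h1 : (d%:Z %| 0 - i0 *+ n)%Z.
  have := dvd _ (word_diff_word ai0 pk).
  by rewrite sk; have -> : word_sum k = 0 by rewrite -[LHS]add0r -ek.
have h2 : (d%:Z %| 1 - i0 *+ size k1)%Z.
  by have := dvd _ (word_diff_word ai0 pk1); rewrite sk1.
have -> : (d %| n)%N = (d%:Z %| n%:Z)%Z by [].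
have key (x y m : int) : x = x * (1 - m * y) - y * (0 - m * x) by ring.
have natE m : i0 *+ m = i0 * m%:Z by rewrite -mulr_natr natz.
rewrite !natE in h1 h2; rewrite (key n%:Z (size k1)%:Z i0).
by rewrite rpredB// dvdz_mull.
Qed.

Lemma support_two : exists i j : int, [/\ i != j, 0 < a i & 0 < a j].
Proof.
have [k [k' [sk pk pk' ek]]] := word_diff_unit.
apply: contrapT => hn.
have same i j : 0 < a i -> 0 < a j -> i = j.
  move=> ai aj; apply: contrapT => /eqP ij; apply: hn; by exists i, j.
have cst (i : int) l : 0 < a i -> word_in_support l -> word_sum l = i *+ size l.
  move=> ai; elim: l => [|j l IH] /=; first by rewrite /word_sum big_nil mulr0n.
  move=> /andP[aj pl]; rewrite /word_sum big_cons -/(word_sum l) IH// mulrS.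
  by rewrite (same i j).
case: k sk pk ek => [|i k] sk pk ek.
  by case: k' sk pk' ek => //; rewrite /word_sum big_nil.
have ai : 0 < a i by case/andP: pk.
move: ek; rewrite (cst i)// (cst i)// -sk -[LHS]addr0 => /addrI; lia.
Qed.

End support_words.

(** * Second moments *)

Section moments.
Context {R : realType}.

Definition int_enum (n : nat) : int := if odd n then Negz n./2 else Posz n./2.

Lemma int_enum_bij : set_bij [set: nat] [set: int] int_enum.
Proof.
split=> //.
- move=> m n _ _; rewrite /int_enum.
  have := odd_double_half m; have := odd_double_half n.
  by case: (odd m); case: (odd n) => //= hn hm [] e; rewrite -hm -hn e.
- move=> [n|n] _ /=.
    by exists n.*2 => //; rewrite /int_enum odd_double doubleK.
  exists n.*2.+1 => //; rewrite /int_enum /= odd_double /=.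
  by rewrite uphalf_double.
Qed.

Lemma integral_int_esum (q : probability int R) (g : int -> \bar R) :
  (forall k, 0 <= g k)%E -> (\int[q]_k g k = \esum_(k in [set: int]) (q [set k] * g k))%E.
Proof.
move=> g0.
have h : [set: int] = \bigcup_n [set int_enum n].
  apply/seteqP; split => // z _; have [_ _ /(_ z I)[n _ <-]] := int_enum_bij.
  by exists n.
rewrite {1}h ge0_integral_bigcup//; last first.
  have [_ inj _] := int_enum_bij.
  by move=> i j _ _ [z [/= -> /inj]]; apply; exact: mem_set.
rewrite nneseries_esumT; last by move=> n; exact: integral_ge0.
rewrite (reindex_esum setT setT int_enum); last exact: int_enum_bij.
apply: eq_esum => n _.
rewrite (eq_integral (fun=> g (int_enum n))); last by move=> z; rewrite inE => ->.
by rewrite integral_cst// muleC.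
Qed.

Lemma sq_le_exp (dl x : R) : 0 < dl ->
  x ^+ 2 <= 4 / dl ^+ 2 * (expR (dl * x) + expR (- dl * x)).
Proof.
move=> d0.
have half (y : R) : 0 <= y -> y ^+ 2 <= 4 * expR y.
  move=> y0; have -> : expR y = expR (y / 2) ^+ 2.
    by rewrite -expRM_natl; congr expR; field.
  by have := expR_ge1Dx (y / 2); nra.
have e1 := expR_ge0 (dl * x); have e2 := expR_ge0 (- dl * x).
have : (dl * x) ^+ 2 <= 4 * (expR (dl * x) + expR (- dl * x)).
  have [x0|x0] := leP 0 x.
    by have := half (dl * x) (mulr_ge0 (ltW d0) x0); lra.
  have := half (- dl * x); rewrite mulNr sqrrN => h.
  have : 0 <= - (dl * x) by rewrite oppr_ge0 pmulr_rle0// ltW.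
  by move=> /h; rewrite mulNr in e2 *; lra.
have d2 : 0 < dl ^+ 2 by rewrite exprn_gt0.
move=> h; rewrite mulrAC ler_pdivlMr// mulrC -exprMn.
by [].
Qed.

Variables (a : int -> R) (dl c0 : R).
Hypothesis dl0 : 0 < dl.

Lemma Mclass_second_moment (q : probability int R) : Mclass a dl c0 q ->
  (\int[q]_k ((k%:~R ^+ 2)%:E) <= (8 * c0 / dl ^+ 2)%:E)%E.
Proof.
move=> [qe _].
have mom t : `|t| <= dl -> (\int[q]_k (expR (t * k%:~R))%:E <= c0%:E)%E.
  move=> td; rewrite integral_int_esum; last by move=> k; rewrite lee_fin expR_ge0.
  by apply: le_trans qe; apply: ereal_sup_ubound; exists t.
have m1 := mom dl _; have m2 := mom (- dl) _.
rewrite normrN in m2; rewrite ger0_norm ?(ltW dl0)// in m1 m2.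
have {}m1 := m1 (lexx _); have {}m2 := m2 (lexx _).
have d2 : 0 < 4 / dl ^+ 2 by rewrite divr_gt0// exprn_gt0.
apply: (@le_trans _ _ (\int[q]_k ((4 / dl ^+ 2)%:E *
    ((expR (dl * k%:~R))%:E + (expR (- dl * k%:~R))%:E)))%E).
  apply: ge0_le_integral => //.
  - by move=> k _; rewrite lee_fin sqr_ge0.
  - by move=> k _; rewrite -EFinD -EFinM lee_fin sq_le_exp.
rewrite ge0_integralZl ?lee_fin ?(ltW d2)//; last first.
  by move=> k _; rewrite -EFinD lee_fin addr_ge0 ?expR_ge0.
rewrite ge0_integralD//; try by move=> k _; rewrite lee_fin expR_ge0.
have -> : (8 * c0 / dl ^+ 2)%:E = ((4 / dl ^+ 2)%:E * (c0%:E + c0%:E))%E.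
  by rewrite -EFinD -EFinM; congr EFin; field; rewrite gt_eqF.
by apply: lee_wpmul2l; [rewrite lee_fin ltW|exact: leeD].
Qed.

Lemma second_moment_integrable (q : probability int R) (M : R) :
  (\int[q]_k ((k%:~R ^+ 2)%:E) <= M%:E)%E ->
  q.-integrable setT (fun k => ((k%:~R : R) ^+ 2)%:E).
Proof.
move=> h; apply/integrableP; split => //.
under eq_integral do rewrite gee0_abs ?lee_fin ?sqr_ge0//.
by apply: le_lt_trans h _; rewrite ltry.
Qed.

End moments.

(** * Constants uniform over the class *)

Section class_constants.
Context {R : realType}.
Variable a : int -> R.
Hypothesis a0 : forall i, 0 <= a i.

Lemma run_word (p : nat -> law R) k i f s :
  (forall i k, a k <= mass (p i) k) -> quad_growth f -> (forall z, 0 <= f z) ->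
  (\prod_(x <- k) a x) * f (s + word_sum k) <= run p free i (size k) f s.
Proof.
move=> ap qf f0; elim: k i s => [|x k IH] i s.
  by rewrite /word_sum !big_nil mul1r addr0.
rewrite [size _]/= run_freeS big_cons /word_sum big_cons -/(word_sum k) addrA.
set g := run p free i.+1 (size k) f.
have qg : quad_growth g by exact: quad_growth_run.
have g0 z : 0 <= g z by exact: run_ge0.
have := @E_ge_mass R (p i) (fun z => g (s + z)) [:: x] isT.
move=> /(_ (quad_growth_comp false s qg) (fun z => g0 _)).
rewrite big_seq1; apply: le_trans; rewrite -mulrA.
by apply: ler_pM => //; [rewrite mulr_ge0 ?prodr_ge0|exact: IH].
Qed.

Lemma split_constants : irreducible_aperiodic_seq a -> exists (N : nat) (b : int) (eps : R),
  [/\ (0 < N)%N, 0 < eps & forall p : nat -> law R, (forall i k, a k <= mass (p i) k) ->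
   forall i f s, quad_growth f -> (forall z, 0 <= f z) ->
   eps * (f (s + b) + f (s + b + 1)) <= run p free i N f s].
Proof.
move=> ia; have [k [k' [sk pk pk' ek]]] := word_diff_unit ia.
have prod_gt0 l : word_in_support a l -> 0 < \prod_(x <- l) a x.
  by move=> pl; rewrite big_seq prodr_gt0// => i il; exact: (allP pl).
have h1 := prod_gt0 _ pk; have h2 := prod_gt0 _ pk'.
set e1 := \prod_(x <- k) a x in h1; set e2 := \prod_(x <- k') a x in h2.
exists (size k), (word_sum k), (Num.min e1 e2 / 2); split.
- case: k sk pk ek @e1 h1 => //; case: k' {pk' e2 h2} => // _ _.
  by rewrite /word_sum !big_nil.
- by rewrite divr_gt0// lt_min h1.
- move=> p ap i f s qf f0.
  have r1 := run_word k i s ap qf f0; have r2 := run_word k' i s ap qf f0.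
  rewrite -sk ek addrA -/e2 in r2; rewrite -/e1 in r1.
  have m1 : Num.min e1 e2 <= e1 by rewrite ge_min lexx.
  have m2 : Num.min e1 e2 <= e2 by rewrite ge_min lexx orbT.
  have := ler_wpM2r (f0 (s + word_sum k)) m1.
  have := ler_wpM2r (f0 (s + word_sum k + 1)) m2.
  lra.
Qed.

(** Two points of the support carry fixed masses and lie at distance at least 1,
    so one of them is at distance 1 / 2 or more from the mean. *)
Lemma regular_constants (sg2 : R) : irreducible_aperiodic_seq a ->
  (forall i, a i <= 1) -> 1 / 2 <= sg2 ->
  exists s0 B : R, [/\ 0 < s0, 0 < B, s0 <= sg2 & forall q : law R,
    (forall k, a k <= mass q k) -> E q (fun k => k%:~R ^+ 2) <= sg2 ->
    regular sg2 s0 B q].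
Proof.
move=> ia a1 sg; have [i [j [ij ai aj]]] := support_two ia.
exists (Num.min (a i) (a j) / 2), (`|i%:~R| + `|j%:~R| + 1 + sg2); split.
- by rewrite divr_gt0// lt_min ai.
- have := normr_ge0 (i%:~R : R); have := normr_ge0 (j%:~R : R); lra.
- have : Num.min (a i) (a j) <= a i by rewrite ge_min lexx.
  have := a1 i; lra.
move=> q aq; rewrite -mean_var_sq => h; split.
  by have := sqr_ge0 (lmean q); lra.
have v0 := lvar_ge0 q; set mu := lmean q in h *.
have mu1 : `|mu| <= 1 + sg2.
  have : `|mu| ^+ 2 <= sg2 by rewrite real_normK ?num_real//; lra.
  have := normr_ge0 mu; nra.
have ub : uniq [:: i; j] by rewrite /= inE ij.
rewrite /trunc_var.
have := E_ge_mass q ub (quad_growth_near (`|i%:~R| + `|j%:~R| + 1 + sg2) q).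
have pos (k : int) : 0 <= (k%:~R - lmean q) ^+ 2 *
   near_mean (`|i%:~R| + `|j%:~R| + 1 + sg2) q k.
  by rewrite mulr_ge0 ?sqr_ge0// /near_mean ler0n.
move=> /(_ pos); apply: le_trans; rewrite big_cons big_seq1 /near_mean -/mu.
have i0 := normr_ge0 (i%:~R : R); have j0 := normr_ge0 (j%:~R : R).
have -> : `|i%:~R - mu| <= `|i%:~R| + `|j%:~R| + 1 + sg2.
  by apply: le_trans (ler_normB _ _) _; lra.
have -> : `|j%:~R - mu| <= `|i%:~R| + `|j%:~R| + 1 + sg2.
  by apply: le_trans (ler_normB _ _) _; lra.
rewrite !mulr1; set m := Num.min _ _.
have m0 : 0 < m by rewrite lt_min ai.
have mi : m <= mass q i by apply: le_trans (aq i); rewrite ge_min lexx.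
have mj : m <= mass q j by apply: le_trans (aq j); rewrite ge_min lexx orbT.
have d1 : 1 <= (i%:~R - j%:~R) ^+ 2 :> R.
  by rewrite -rmorphB -rmorphXn /= ler1z -gtz0_ge1 exprn_even_gt0//= subr_eq0.
have h1 := ler_wpM2r (sqr_ge0 (i%:~R - mu)) mi.
have h2 := ler_wpM2r (sqr_ge0 (j%:~R - mu)) mj.
have h3 : 1 / 2 <= (i%:~R - mu) ^+ 2 + (j%:~R - mu) ^+ 2.
  have := sqr_ge0 (i%:~R - mu + (j%:~R - mu)); lra.
have := ler_wpM2l (ltW m0) h3; lra.
Qed.

End class_constants.

(** * Path probabilities *)

Section path_probability.
Context {R : realType} d (T : measurableType d) (P : probability T R) (n : nat)
  (X : 'I_n -> {RV P >-> int}).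
Hypothesis indep : independent_RVs X.

(** There are countably many paths, and the event that the walk follows a given
    one is measurable. *)
Lemma measurable_functional (phi : ('I_n -> int) -> Prop) :
  measurable [set w | phi (fun i => X i w)].
Proof.
have -> : [set w | phi (fun i => X i w)] =
    \bigcup_(x : {ffun 'I_n -> int})
      [set w | phi (fun i => x i) /\ forall i, i \in enum 'I_n -> X i w = x i].
  apply/seteqP; split => w /=.
    move=> h; exists [ffun i => X i w] => //=; split.
      by rewrite (_ : (fun i => _) = fun i => X i w)//; apply/funext => i; rewrite ffunE.
    by move=> i _; rewrite ffunE.
  move=> [x _ [h e]]; rewrite (_ : (fun i => _) = fun i => x i)//.
  by apply/funext => i; apply: e; rewrite mem_enum.
apply: countable_bigcupT_measurable; first exact: countableP.
move=> x; have [h|h] := pselect (phi (fun i => x i)); last first.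
  by rewrite (_ : [set w | _] = set0)//; apply/seteqP; split => // w [].
rewrite (_ : [set w | _] = [set w | forall i, i \in enum 'I_n -> X i w = x i]); last first.
  by apply/seteqP; split => w /=; [case|split].
elim: (enum 'I_n) => [|i r IH].
  by rewrite (_ : [set w | _] = setT)//; apply/seteqP; split.
rewrite (_ : [set w | _] = (X i @^-1` [set x i])
    `&` [set w | forall i, i \in r -> X i w = x i]).
  apply: measurableI => //; rewrite -[_ @^-1` _]setTI.
  exact: (measurable_funP (X i)).
apply/seteqP; split => w /=.
  move=> e; split; first by apply: e; rewrite mem_head.
  by move=> j jr; apply: e; rewrite inE jr orbT.
move=> [e1 e2] j; rewrite inE => /orP[/eqP ->//|]; exact: e2.
Qed.

Lemma sum_disjoint_le (I : eqType) (r : seq I) (A : I -> set T) (B : set T) :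
  uniq r -> (forall i, measurable (A i)) -> measurable B ->
  (forall i j, i != j -> A i `&` A j = set0) ->
  (forall i, i \in r -> A i `<=` B) ->
  (\sum_(i <- r) P (A i) <= P B)%E.
Proof.
move=> ur mA mB disj; elim: r B ur mB => [|i r IH] B /=; first by rewrite big_nil.
move=> /andP[ir ur] mB AB; rewrite big_cons.
have AiB : A i `<=` B by apply: AB; rewrite mem_head.
have -> : P B = (P (A i) + P (B `\` A i))%E.
  rewrite -measureU//; last 2 first.
  - exact: measurableD.
  - by rewrite setDE setICA setICr setI0.
  by congr (P _); rewrite setDUK.
apply: leeD => //; apply: IH => //; first exact: measurableD.
move=> j jr w Ajw; split; first by apply: (AB j) => //; rewrite inE jr orbT.
move=> Aiw; have ij : i != j by apply: contraNneq ir => ->.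
by have : (A i `&` A j) w by []; rewrite disj.
Qed.

Variables (p : nat -> law R).
Hypothesis pX : forall i : 'I_n, law_prob (p i) = distribution P (X i).

Definition partial (j l : nat) (w : T) : int := \sum_(i < n | (j <= i < l)%N) X i w.

Definition cyl (j : nat) (x : nat -> int) : set T :=
  [set w | forall i : 'I_n, (i < j)%N -> X i w = x i].

(** What remains to be satisfied after time j by a path at s at that time. *)
Definition tail_event (wd : nat -> int -> bool) (j : nat) (s t : int) : set T :=
  [set w | (forall l, (j < l <= n)%N -> wd l (s + partial j l w))
           /\ s + partial j n w = t].

Lemma cyl_prob j x : P (cyl j x) = (\prod_(i < n | (i < j)%N) mass (p i) (x i))%:E.
Proof.
have -> : cyl j x = [set w | forall i, i \in [set i : 'I_n | (i < j)%N]%SET ->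
    [set x i] (X i w)].
  by apply/seteqP; split => w /= h i; [rewrite inE => ij; exact: h
    |move=> ij; apply: h; rewrite inE].
rewrite (indep [set i : 'I_n | (i < j)%N]%SET (A := fun i => [set x i]))//.
rewrite -prodEFin; apply: eq_big => [i|i _]; first by rewrite inE.
by rewrite -massE pX.
Qed.

Lemma partialS j l w (jn : (j < n)%N) : (j < l)%N ->
  partial j l w = X (Ordinal jn) w + partial j.+1 l w.
Proof.
move=> jl; rewrite /partial (bigD1 (Ordinal jn)) /=; last by rewrite leqnn.
congr (_ + _); apply: eq_bigl => i.
rewrite -(inj_eq val_inj) /= [(j < i)%N]ltn_neqAle eq_sym.
by case: (j == i); rewrite /= ?andbF ?andbT.
Qed.

Lemma partial_nil j l w : (l <= j)%N -> partial j l w = 0.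
Proof.
move=> lj; rewrite /partial big1// => i /andP[ji il].
by have := leq_ltn_trans (leq_trans lj ji) il; rewrite ltnn.
Qed.

(** Backward induction on j: the cylinders that also fix step j are disjoint and,
    for values in the window, finite in number. *)
Lemma run_le_prob_aux (wd : nat -> int -> bool) (F : seq int) t : uniq F ->
  (forall j z, (0 < j <= n)%N -> wd j z -> z \in F) ->
  forall m j (x : nat -> int) s, (j + m)%N = n ->
  (((\prod_(i < n | (i < j)%N) mass (p i) (x i)) * run p wd j m (delta t) s)%R%:E
    <= P (cyl j x `&` tail_event wd j s t))%E.
Proof.
move=> uF wF; elim=> [|m IH] j x s jm.
  move: jm; rewrite addn0 => jn; rewrite /= /delta.
  have [st|] := eqVneq s t; last by rewrite mulr0.
  rewrite mulr1 -cyl_prob le_eqVlt; apply/orP; left; apply/eqP; congr (P _).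
  apply/seteqP; split => w /=; last by case.
  move=> h; split => //; split; last by rewrite partial_nil ?jn// addr0.
  by move=> l /andP[jl ln]; move: (leq_trans jl ln); rewrite jn ltnn.
have jn : (j < n)%N by rewrite -jm addnS ltnS leq_addr.
pose x' z (i : nat) : int := if i == j then z - s else x i.
have prodE z : \prod_(i < n | (i < j.+1)%N) mass (p i) (x' z i)
    = (\prod_(i < n | (i < j)%N) mass (p i) (x i)) * mass (p j) (z - s).
  rewrite (bigD1 (Ordinal jn)) //= /x' eqxx mulrC; congr (_ * _).
  apply: eq_big => [i|i /andP[ij]].
    by rewrite -(inj_eq val_inj) /= ltnS [RHS]ltn_neqAle andbC.
  by rewrite -(inj_eq val_inj) /= => /negPf ->.
pose A z := if wd j.+1 z then cyl j.+1 (x' z) `&` tail_event wd j.+1 z t else set0.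
have mcyl i y : measurable (cyl i y).
  exact: (measurable_functional (fun X' => forall k : 'I_n, (k < i)%N -> X' k = y k)).
have mtail i y : measurable (tail_event wd i y t).
  exact: (measurable_functional (fun X' => (forall l, (i < l <= n)%N ->
      wd l (y + \sum_(k < n | (i <= k < l)%N) X' k))
    /\ y + \sum_(k < n | (i <= k < n)%N) X' k = t)).
have wF1 z : wd j.+1 z -> z \in F by apply: wF.
set Q := fun z => (wd j.+1 z)%:R * run p wd j.+1 m (delta t) z.
have QF z : Q z != 0 -> z \in F.
  by rewrite /Q; have [/wF1//|] := boolP (wd j.+1 z); rewrite mul0r eqxx.
rewrite (_ : run p wd j m.+1 (delta t) s = shift false (p j) Q s)//.
rewrite (shift_finite _ _ uF QF) mulr_sumr -sumEFin.
apply: (@le_trans _ _ (\sum_(z <- F) P (A z))%E).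
  apply: lee_sum => z _; rewrite /A /Q; case: ifP => wz; last by rewrite mul0r !mulr0.
  by rewrite mul1r mulrA -prodE; apply: IH; rewrite addSnnS.
apply: sum_disjoint_le => //.
- by move=> z; rewrite /A; case: ifP => // _; exact: measurableI.
- exact: measurableI.
- move=> y z yz; rewrite /A; case: ifP => _; last by rewrite set0I.
  case: ifP => _; last by rewrite setI0.
  apply/seteqP; split => // w [[hy _] [hz _]].
  have := hy (Ordinal jn) (ltnSn j); rewrite (hz (Ordinal jn) (ltnSn j)).
  by rewrite /x' /= eqxx => /addIr zy; rewrite zy eqxx in yz.
- move=> z zF w; rewrite /A; case: ifP => // wz [hc [ht1 ht2]].
  have Xj : X (Ordinal jn) w = z - s.
    by rewrite (hc (Ordinal jn) (ltnSn j)) /x' /= eqxx.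
  have sX l : s + (z - s + l) = z + l by rewrite addrA [s + _]addrC subrK.
  split.
    move=> i ij; rewrite hc ?ltnS ?(ltnW ij)// /x'.
    by rewrite (ltn_eqF ij).
  split; last by rewrite (partialS _ jn)// Xj sX.
  move=> l /andP[jl ln]; rewrite (partialS _ jn)// Xj sX.
  have [jl'|lj] := ltnP j.+1 l; first by apply: ht1; rewrite jl' ln.
  have -> : l = j.+1 by apply/eqP; rewrite eqn_leq lj.
  by rewrite partial_nil// addr0.
Qed.

Lemma run_le_prob (wd : nat -> int -> bool) (F : seq int) t : uniq F ->
  (forall j z, (0 < j <= n)%N -> wd j z -> z \in F) ->
  ((run p wd 0 n (delta t) 0)%:E <= P (tail_event wd 0 0 t))%E.
Proof.
move=> uF wF; have := run_le_prob_aux t uF wF (fun=> 0) 0 (add0n n).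
rewrite big_pred0 ?mul1r; last by move=> i.
by rewrite (_ : cyl 0 _ = setT) ?setTI//; apply/seteqP; split.
Qed.


End path_probability.

(** * Gluing the pieces *)

Lemma window_finite {R : realType} (p : nat -> law R) (x0 lam : R) n : exists2 F : seq int, uniq F &
  forall j z, (j <= n)%N -> win p x0 lam j z -> z \in F.
Proof.
pose M : R := `|x0| + `|lam| + \sum_(j < n.+1) `|mean_sum p 0 j|.
pose L := (Num.truncn M).+1.
exists [seq (Posz i - Posz L)%R | i <- iota 0 (2 * L).+1].
  by rewrite map_inj_uniq ?iota_uniq// => x y /addIr [].
move=> j z jn; rewrite /win => h.
have zM : `|z%:~R| <= M.
  have -> : (z%:~R : R) = cpos p x0 j z - x0 + mean_sum p 0 j by rewrite /cpos; ring.
  have mj : `|mean_sum p 0 j| <= \sum_(j < n.+1) `|mean_sum p 0 j|.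
    rewrite (bigD1 (Ordinal (jn : (j < n.+1)%N)))//= lerDl.
    by apply: sumr_ge0.
  have h1 := ler_normD (cpos p x0 j z - x0) (mean_sum p 0 j).
  have h2 := ler_normB (cpos p x0 j z) x0.
  have h3 := ler_norm lam; have h4 := normr_ge0 lam.
  rewrite /M; lra.
have M0 : 0 <= M by exact: le_trans zM.
have ML : M < L%:R by rewrite /L; have := Num.Theory.truncnS_gt M.
have zL : `|z| < L%:Z.
  by rewrite -(ltr_int R) intr_norm; exact: le_lt_trans zM ML.
move: L zL {ML} => L zL.
apply/mapP; exists (absz (z + Posz L)); last by lia.
by rewrite mem_iota add0n; lia.
Qed.


Section bridge.
Context {R : realType}.
Variables (p : nat -> law R) (x0 lam eta : R) (sg2 s0 B kap : R).
Variables (N : nat) (b : int) (eps : R).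
Hypotheses (sg2_gt0 : 0 < sg2) (s0_gt0 : 0 < s0) (B0 : 0 < B) (eta0 : 0 < eta)
  (eta2 : eta <= 1 / 2) (kap0 : 0 <= kap) (s0_le : s0 <= sg2).
Hypothesis reg : forall i, regular sg2 s0 B (p i).
Hypothesis lamL : lam_large lam eta sg2 s0 B kap.
Hypotheses (eps0 : 0 < eps) (N0 : (0 < N)%N).
Hypothesis split_block : forall i f s, quad_growth f -> (forall z, 0 <= f z) ->
  eps * (f (s + b) + f (s + b + 1)) <= run p free i N f s.

Local Notation win := (win p x0 lam).
Local Notation mid := (mid p x0 lam eta).
Local Notation cpos := (cpos p x0).
Local Notation A := (curvature sg2 s0 eta kap).
Local Notation c := (decay_rate sg2 s0 eta kap).
Local Notation lo := (low_const N eps sg2).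

Lemma mid_win j s : mid j s != 0 -> win j s.
Proof.
rewrite /mid /win; have l0 := lam_large_gt0 lamL.
case: (boolP (`|cpos j s| <= eta * lam)) => [h _|]; last by rewrite eqxx.
apply: le_trans h _; rewrite mulrC ler_pM2l//.
by move: (eta2); rewrite mul1r.
Qed.

(** Sum over the two points, at the ends of the middle piece, that lie in the
    middle part of the window; there the middle factor is bounded below
    uniformly, so the sum factorizes, and duality turns the sum over the second
    point into a walk from t backwards in time. *)
Lemma bridge_lower (n1 H n3 : nat) (t : int) (F : seq int) :
  let m := (H * N + H * N)%N in let n := (n1.+1 + (m + n3.+1))%N in
  uniq F -> (forall j z, (j <= n)%N -> win j z -> z \in F) ->
  (0 < H)%N ->
  64 * (3 * (spread N sg2 / eps) + 1) + 3 <= eps * (2 * H%:R) ->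
  4 <= eps ^+ 2 * (2 * H%:R) ->
  2 * H%:R <= lam ^+ 2 ->
  H%:R * (2 + 4 * N%:R * sg2) <= stay_const N eps sg2 * lam ^+ 2 ->
  2 * (eta * lam) ^+ 2 <= H%:R ->
  lam ^+ 2 / 4 <= eta ^+ 2 * lam ^+ 2 + kap * n1.+1%:R ->
  lam ^+ 2 / 4 <= eta ^+ 2 * lam ^+ 2 + kap * n3.+1%:R ->
  win 0 0 -> win n t ->
  lo / (4 * Num.sqrt H%:R)
   * ((1 - c / lam ^+ 2) ^+ n1 * (start_gain s0 B * (lam / 2 - `|cpos 0 0| + 1) / lam) / (1 + A))
   * ((1 - c / lam ^+ 2) ^+ n3 * (start_gain s0 B * (lam / 2 - `|cpos n t| + 1) / lam) / (1 + A))
  <= run p win 0 n (delta t) 0.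
Proof.
move=> m n uF wF H0 c1 c2 c3 c4 c5 f1 f3 w0 wt.
have l0 := lam_large_gt0 lamL.
have A0 : 0 < A by exact: curvature_gt0.
have A10 : 0 < 1 + A by lra.
set al := run p win 0 n1.+1 (mid (0 + n1.+1)) 0.
set i2 := (n1.+1 + m)%N.
set be := corun p win i2 n3.+1 (mid i2) t.
have hal : (1 - c / lam ^+ 2) ^+ n1 * (start_gain s0 B * (lam / 2 - `|cpos 0 0| + 1) / lam) / (1 + A) <= al.
  rewrite ler_pdivrMr// mulrC [leRHS]mulrC.
  rewrite mulrC; exact: (forward_landing_first sg2_gt0 s0_gt0 B0 eta0 eta2 kap0 s0_le reg lamL w0 f1).
have nE : n = (i2 + n3.+1)%N by rewrite /n /i2 addnA.
have hbe : (1 - c / lam ^+ 2) ^+ n3 * (start_gain s0 B * (lam / 2 - `|cpos n t| + 1) / lam) / (1 + A) <= be.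
  rewrite ler_pdivrMr// mulrC [leRHS]mulrC mulrC nE.
  apply: (backward_landing_first sg2_gt0 s0_gt0 B0 eta0 eta2 kap0 s0_le reg lamL _ f3).
  by rewrite -nE.
set cm := lo / (4 * Num.sqrt H%:R).
have cm0 : 0 < cm.
  by rewrite divr_gt0 ?low_const_gt0// mulr_gt0// sqrtr_gt0 ltr0n.
have al0 : 0 <= al by apply: run_ge0 => z; rewrite /mid ler0n.
have be0 : 0 <= be.
  apply: le_trans hbe; have c10 := contraction_ge0 sg2_gt0 s0_gt0 eta0 kap0 lamL.
  have wt' : `|cpos n t| <= lam / 2 by [].
  apply: divr_ge0; last exact: ltW.
  apply: mulr_ge0; first by rewrite exprn_ge0.
  apply: divr_ge0; last exact: ltW.
  by apply: mulr_ge0; [exact/ltW/start_gain_gt0|lra].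
set h3 := run p win i2 n3.+1 (delta t).
have d0 z y : 0 <= delta z y :> R by have /andP[] := @delta01 R z y.
have qd z : quad_growth (delta z : int -> R) by exact: quad_growth_delta.
have h30 z : 0 <= h3 z by exact: run_ge0.
have qh3 : quad_growth h3 by exact: quad_growth_run.
have hbe2 : \sum_(z <- F) mid i2 z * h3 z = be.
  apply: corun_delta => //.
  - by move=> j z /andP[_ jn]; apply: wF; rewrite nE.
  - move=> z /mid_win; apply: wF; rewrite nE; exact: leq_addr.
  - by apply: wF wt; rewrite leqnn.
have hmid s : cm * be * mid n1.+1 s <= run p win n1.+1 m h3 s.
  apply: le_trans (run_ge_window p win n1.+1 m s uF qh3 h30).
  rewrite -hbe2 mulrAC mulrC mulr_suml; apply: ler_sum => z _.
  have [mz|mz] := eqVneq (mid i2 z) 0.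
    by rewrite mz !mul0r mulr_ge0// run_ge0.
  have [ms|ms] := eqVneq (mid n1.+1 s) 0.
    by rewrite ms !mulr0 mulr_ge0// run_ge0.
  have mE j y : mid j y != 0 -> mid j y = 1 /\ 2 * cpos j y ^+ 2 <= H%:R.
    rewrite /mid; case: (boolP (`|cpos j y| <= eta * lam)) => [h _|]; last by rewrite eqxx.
    split=> //; apply: le_trans c5; rewrite ler_pM2l// -(real_normK (num_real (cpos j y))).
    by rewrite ler_pXn2r// ?nnegrE// mulr_ge0// ltW.
  have [-> xz] := mE _ _ mz; have [-> xs] := mE _ _ ms.
  rewrite mul1r mulr1 ler_wpM2l//.
  apply: (middle_lower (V := sg2) l0 eps0 (ltW sg2_gt0) _ split_block uF) => //.
  - by move=> i; have [] := reg i.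
  - move=> j y /andP[_ jm]; apply: wF; rewrite nE; apply: (leq_trans jm); exact: leq_addr.
rewrite /n run_cat run_cat add0n.
apply: (@le_trans _ _ (cm * be * al)); last first.
  have -> : cm * be * al = run p win 0 n1.+1 (fun s => cm * be * mid n1.+1 s) 0.
    by rewrite runZ// ; exact: quad_growth_mid.
  apply: run_le => //.
  - by apply: quad_growthZ; exact: quad_growth_mid.
  - exact: quad_growth_run.
have hbe0 := be0.
rewrite [leRHS]mulrAC.
have c10 := contraction_ge0 sg2_gt0 s0_gt0 eta0 kap0 lamL.
apply: ler_pM => //.
- apply: mulr_ge0; first exact: ltW.
  apply: divr_ge0; last exact: ltW.
  apply: mulr_ge0; first by rewrite exprn_ge0.
  apply: divr_ge0; last exact: ltW.
  have w0' : `|cpos 0 0| <= lam / 2 by [].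
  by apply: mulr_ge0; [exact/ltW/start_gain_gt0|lra].
- apply: divr_ge0; last exact: ltW.
  apply: mulr_ge0; first by rewrite exprn_ge0.
  apply: divr_ge0; last exact: ltW.
  have wt' : `|cpos n t| <= lam / 2 by [].
  by apply: mulr_ge0; [exact/ltW/start_gain_gt0|lra].
- by rewrite ler_pM2l.
Qed.

End bridge.

(** * The events of the centred walk *)

Section walk_events.
Context {R : realType}.

Lemma bigmin_seq_ge (m x : R) (r : seq nat) (G : nat -> R) :
  (m <= \big[Num.min/x]_(i <- r) G i) = (m <= x) && all (fun i => m <= G i) r.
Proof.
elim: r => [|i r IH]; first by rewrite big_nil andbT.
by rewrite big_cons le_min IH /= andbCA.
Qed.

Lemma bigmax_seq_le (m x : R) (r : seq nat) (G : nat -> R) :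
  (\big[Num.max/x]_(i <- r) G i <= m) = (x <= m) && all (fun i => G i <= m) r.
Proof.
elim: r => [|i r IH]; first by rewrite big_nil andbT.
by rewrite big_cons ge_max IH /= andbCA.
Qed.

Context d (T : measurableType d) (P : probability T R) (n : nat)
  (X : 'I_n -> {RV P >-> int}) (p : nat -> law R).
Hypothesis pX : forall i : 'I_n, law_prob (p i) = distribution P (X i).

Lemma lmean_distribution (i : 'I_n) :
  fine 'E_P[fun w => (X i w)%:~R : R] = lmean (p i).
Proof.
have q1 : quad_growth (fun k : int => k%:~R : R).
  have := quad_growth_poly (0 : R) 1 0; congr quad_growth; apply/funext => k.
  by rewrite add0r mul1r mul0r addr0.
have := quad_growth_integrable (p i) q1; rewrite pX => /integrableP[_ h].
rewrite unlock /lmean /E /Rintegral pX integral_distribution//.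
apply/integrableP; split.
  by move=> mT Y _; rewrite comp_preimage; exact: (measurable_funP (X i)).
by move: h; rewrite ge0_integral_distribution.
Qed.

Lemma Sbar_partial (u : R) k w : (k <= n)%N ->
  Sbar X u k w = u + (partial X 0 k w)%:~R - mean_sum p 0 k.
Proof.
move=> kn; rewrite /Sbar /partial /mean_sum add0n.
rewrite big_mkord (big_ord_widen n (fun j => lmean (p j)) kn) -addrA; congr (_ + _).
rewrite rmorph_sum -sumrB; apply: eq_bigr => i _.
by rewrite /centered lmean_distribution.
Qed.

Lemma walk_event (u v lam x0 : R) (t : int) : (0 < n)%N -> x0 = u - lam / 2 ->
  v = u + t%:~R - mean_sum p 0 n ->
  [set w | [/\ (0 <= Sbar_min X u w)%R, (Sbar_max X u w <= lam)%R & Sbar X u n w = v]]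
  = tail_event X (win p x0 lam) 0 0 t.
Proof.
move=> n0 x0E vE.
have winE k w : (k <= n)%N ->
    win p x0 lam k (partial X 0 k w) = (0 <= Sbar X u k w <= lam)%R.
  move=> kn; rewrite Sbar_partial// /win /cpos x0E ler_norml.
  by apply/andP/andP => -[h1 h2]; split; lra.
have SnE w : Sbar X u n w = v <-> partial X 0 n w = t.
  rewrite Sbar_partial// vE; split=> [|->//].
  by move/addIr/addrI/intr_inj.
apply/seteqP; split => w /=.
  move=> [hmin hmax hn]; split; last by rewrite add0r; apply/SnE.
  move=> l /andP[l0 ln]; rewrite add0r winE//.
  move: hmin hmax; rewrite /Sbar_min /Sbar_max bigmin_seq_ge bigmax_seq_le.
  move=> /andP[_ /allP hmin] /andP[_ /allP hmax].
  by rewrite hmin ?hmax// mem_index_iota l0 ltnS.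
move=> [hw]; rewrite add0r => /SnE hn.
have hs l : (0 < l <= n)%N -> 0 <= Sbar X u l w <= lam.
  by move=> /andP[l0 ln]; rewrite -winE//; have := hw l; rewrite add0r l0 ln; exact.
have [hn0 hn1] := andP (hs n ltac:(by rewrite n0 leqnn)).
split => //.
  rewrite /Sbar_min bigmin_seq_ge hn0 /=; apply/allP => l.
  by rewrite mem_index_iota ltnS => /hs /andP[].
rewrite /Sbar_max bigmax_seq_le hn1 /=; apply/allP => l.
by rewrite mem_index_iota ltnS => /hs /andP[].
Qed.

End walk_events.

Section law_of_class.
Context {R : realType}.
Variables (a : int -> R) (dl c0 : R).
Hypothesis dl0 : 0 < dl.

Lemma Mclass_law (q : probability int R) : Mclass a dl c0 q ->
  exists l : law R, [/\ law_prob l = q, forall k, a k <= mass l k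
    & E l (fun k => k%:~R ^+ 2) <= 8 * c0 / dl ^+ 2].
Proof.
move=> hq; have h := Mclass_second_moment dl0 hq.
exists (Law (second_moment_integrable h)); split => //.
  by move=> k; have [_ /(_ k)] := hq; rewrite -lee_fin -massE.
rewrite /E /Rintegral -lee_fin fineK//.
by apply: integrable_fin_num => //; exact: second_moment_integrable h.
Qed.

End law_of_class.

(** * The uniform estimate *)

Lemma split_time (n m : nat) : (6 <= n)%N -> (3 * m <= n)%N ->
  exists n1 n3, [/\ n = (n1.+1 + (m + n3.+1))%N, (n <= 4 * n1.+1)%N,
    (n <= 4 * n3.+1)%N & (n1 + n3 <= n)%N].
Proof.
move=> n6 mn; exists ((n - m)./2).-1, (n - m - (n - m)./2).-1.
have := odd_double_half (n - m); have := leq_b1 (odd (n - m)).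
set h := (n - m)./2; set o := nat_of_bool _ => o1 oh; split; lia.
Qed.

Section uniform_bound.
Context {R : realType}.

Lemma min_dist (u lam : R) :
  Num.min u (lam - u) = lam / 2 - `|u - lam / 2|.
Proof.
case: (leP u (lam - u)) => h; first by rewrite ler0_norm; lra.
by rewrite ger0_norm; lra.
Qed.

Lemma lam_large_eventually (eta sg2 s0 B kap : R) : 0 < sg2 -> 0 < s0 -> 0 < B ->
  0 < eta -> 0 <= kap ->
  exists2 l0, 4 <= l0 & forall lam, l0 <= lam -> lam_large lam eta sg2 s0 B kap.
Proof.
move=> sg0 s00 B0 eta0 kap0.
have A0 : 0 < curvature sg2 s0 eta kap by exact: curvature_gt0.
have c0 : 0 < decay_rate sg2 s0 eta kap by exact: decay_rate_gt0.
have B20 := sqr_ge0 B; have F20 := sqr_ge0 (wide_range sg2 s0 B).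
rewrite /lam_large; move: A0 c0 F20.
set A := curvature _ _ _ _; set c := decay_rate _ _ _ _; set F2 := wide_range _ _ _ ^+ 2 => A0 c0 F20.
pose t1 := A * (kap + B ^+ 2) ^+ 2; pose t2 := A * (kap + B + B ^+ 2).
pose t3 := 16 * B * (kap + F2) / s0.
have t10 : 0 <= t1 by rewrite mulr_ge0 ?sqr_ge0// ltW.
have t20 : 0 <= t2 by apply: mulr_ge0; lra.
have t30 : 0 <= t3 by apply: divr_ge0; [apply: mulr_ge0; lra|exact: ltW].
exists (4 + t1 + t2 + t3 + 2 * c) => [|lam hl]; first by lra.
have l4 : 4 <= lam by lra.
have lsq : lam <= lam ^+ 2 by nra.
split; rewrite -/t1//; [by lra| |by rewrite -ler_pdivrMr// -/t3; lra|by lra].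
apply: (@le_trans _ _ (t2 * lam)); last by rewrite expr2 ler_wpM2r//; lra.
rewrite /t2 -mulrA; apply: ler_wpM2l; first exact: ltW.
have := mulr_ge0 kap0 (_ : 0 <= lam - 1); have := mulr_ge0 B20 (_ : 0 <= lam - 1).
by move=> /(_ ltac:(lra)) ? /(_ ltac:(lra)) ?; lra.
Qed.

Lemma block_count (x : R) : 2 <= x ->
  exists H : nat, [/\ (0 < H)%N, H%:R <= x & x <= 2 * H%:R].
Proof.
move=> x2; exists (Num.truncn x).
have h1 : (Num.truncn x)%:R <= x by rewrite truncn_le//; lra.
have h2 : x < (Num.truncn x)%:R + 1 by rewrite natr1; exact: truncnS_gt.
have h3 : (0 < Num.truncn x)%N by rewrite -(ltr_nat R); lra.
have h4 : 1 <= (Num.truncn x)%:R :> R by rewrite ler1n.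
by split => //; lra.
Qed.

Lemma contraction_pow (c lam : R) (n1 n3 n : nat) : 0 < c -> 0 < lam ->
  2 * c <= lam ^+ 2 -> (n1 + n3 <= n)%N ->
  expR (- (2 * c * n%:R / lam ^+ 2))
    <= (1 - c / lam ^+ 2) ^+ n1 * (1 - c / lam ^+ 2) ^+ n3.
Proof.
move=> c0 l0 cl nn; have l20 : 0 < lam ^+ 2 by rewrite exprn_gt0.
have x2 : 0 <= c / lam ^+ 2 <= 1 / 2.
  rewrite divr_ge0 ?(ltW c0) ?(ltW l20)//= ler_pdivrMr//; lra.
have h := expR_le_lin x2; move: x2 h; set x := c / _ => /andP[x0 x1] h.
rewrite -exprD; apply: (@le_trans _ _ ((1 - x) ^+ n)); last by apply: ler_wiXn2l => //; lra.
have -> : - (2 * c * n%:R / lam ^+ 2) = n%:R * (- (2 * x)) by rewrite /x; ring.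
by rewrite expRM_natl lerXn2r// ?nnegrE ?expR_ge0//; lra.
Qed.

(** th is the proportion of lam ^ 2 taken by each half of the middle piece, in
    blocks: small enough for the walk to stay in the window, and for the whole
    piece to last at most n / 3. *)
Lemma middle_fraction (K V sc : R) (N : nat) : 0 <= V -> 0 < sc ->
  exists th : R, [/\ 0 < th, th <= 1 / 2, th * (2 + 4 * N%:R * V) <= sc
    & th * (6 * N%:R * K ^+ 2) <= 1].
Proof.
move=> V0 sc0; have NV : 0 <= N%:R * V by rewrite mulr_ge0.
pose D1 := (2 + 4 * N%:R * V) / sc; pose D2 := 6 * N%:R * K ^+ 2.
have D10 : 0 <= D1 by apply: divr_ge0; [lra|exact: ltW].
have D20 : 0 <= D2 by rewrite mulr_ge0 ?sqr_ge0 ?mulr_ge0.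
pose D := 2 + D1 + D2; have D0 : 0 < D by rewrite /D; lra.
exists D^-1; split.
- by rewrite invr_gt0.
- by rewrite mul1r lef_pV2 ?posrE// /D; lra.
- rewrite mulrC ler_pdivrMr// -ler_pdivrMl// mulrC -/D1 /D; lra.
- by rewrite mulrC ler_pdivrMr// mul1r -/D2 /D; lra.
Qed.

(** All constants depend on a, K and the moment bound only: the steps enter
    through the support of a and through second moments. *)
Lemma bridge_uniform (a : int -> R) (K M : R) :
  (forall i, 0 <= a i <= 1) -> irreducible_aperiodic_seq a -> 0 < M ->
  exists C c l0 : R, [/\ 0 < C, 0 < c, 4 <= l0 &
    forall (p : nat -> law R), (forall i k, a k <= mass (p i) k) ->
      (forall i, E (p i) (fun k => k%:~R ^+ 2) <= M) ->
    forall (n : nat) (lam x0 : R) (t : int), (6 <= n)%N -> l0 <= lam ->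
      lam ^+ 2 <= K ^+ 2 * n%:R ->
      `|cpos p x0 0 0| <= lam / 2 -> `|cpos p x0 n t| <= lam / 2 ->
    C * (lam / 2 - `|cpos p x0 0 0| + 1) * (lam / 2 - `|cpos p x0 n t| + 1)
      / lam ^+ 3 * expR (- (c * n%:R / lam ^+ 2))
    <= run p (win p x0 lam) 0 n (delta t) 0].
Proof.
move=> a01 ha M0.
have a0 i : 0 <= a i by case/andP: (a01 i).
have a1 i : a i <= 1 by case/andP: (a01 i).
pose sg2 := M + 1.
have sg0 : 0 < sg2 by rewrite /sg2; lra.
have [s0 [B [s00 B0 s0sg regc]]] : exists s0 B : R, [/\ 0 < s0, 0 < B, s0 <= sg2
    & forall q : law R, (forall k, a k <= mass q k) ->
      E q (fun k => k%:~R ^+ 2) <= sg2 -> regular sg2 s0 B q].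
  by apply: regular_constants => //; rewrite /sg2; lra.
have [N [b [eps [N0 eps0 splitc]]]] := split_constants a0 ha.
pose lo := low_const N eps sg2; pose sc := stay_const N eps sg2.
have lo0 : 0 < lo by exact: low_const_gt0.
have sc0 : 0 < sc by rewrite /sc /stay_const divr_gt0// mulr_gt0// up_const_gt0.
have [th [th0 th2 thV thK]] := middle_fraction K N (ltW sg0) sc0.
(* 2 eta ^ 2 lam ^ 2 <= H puts any two points of the middle part within the range
   of the local lower bound; kap lets the funnel fill the window in n / 4 steps,
   because n >= lam ^ 2 / K ^ 2 *)
pose eta := th / 2; pose kap := 4 * K ^+ 2.
have eta0 : 0 < eta by rewrite divr_gt0.
have eta2 : eta <= 1 / 2 by rewrite /eta; lra.
have kap0 : 0 <= kap by rewrite mulr_ge0// sqr_ge0.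
pose A := curvature sg2 s0 eta kap; pose c := decay_rate sg2 s0 eta kap.
have A0 : 0 < A by exact: curvature_gt0.
have cc0 : 0 < c by exact: decay_rate_gt0.
pose cb := 64 * (3 * (spread N sg2 / eps) + 1) + 3.
have cb0 : 0 <= cb / eps.
  have := spread_ge1 N (ltW sg0) => sp.
  have sp0 : 0 <= spread N sg2 / eps by apply: divr_ge0; [lra|exact: ltW].
  by apply: divr_ge0; [rewrite /cb; lra|exact: ltW].
have e40 : 0 <= 4 / eps ^+ 2 by rewrite divr_ge0// sqr_ge0.
have [l1 l14 l1P] := lam_large_eventually sg0 s00 B0 eta0 kap0.
pose l2 := (2 + cb / eps + 4 / eps ^+ 2) / th.
have l20 : 0 <= l2 by apply: divr_ge0; [lra|exact: ltW].
have fb0 : 0 < start_gain s0 B by exact: start_gain_gt0.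
exists (lo / 4 * (start_gain s0 B / (1 + A)) ^+ 2), (2 * c), (l1 + l2).
split=> [|||p pa pM n lam x0 t n6 lamlam0 lam2 wx wt].
- apply: mulr_gt0; first exact: divr_gt0.
  by rewrite exprn_gt0// divr_gt0//; lra.
- by lra.
- by lra.
have lamL : lam_large lam eta sg2 s0 B kap by apply: l1P; lra.
have lam4 : 4 <= lam by lra.
have lam0 : 0 < lam by lra.
have lamN : lam != 0 by rewrite gt_eqF.
have lsq0 : 0 < lam ^+ 2 by rewrite exprn_gt0.
have reg i : regular sg2 s0 B (p i) by apply: regc => //; have := pM i; rewrite /sg2; lra.
have split_block := splitc p pa.
have [F uF wF] := window_finite p x0 lam n.
have thl : 2 + cb / eps + 4 / eps ^+ 2 <= th * lam ^+ 2.
  rewrite [leRHS]mulrC -ler_pdivrMr// -/l2 expr2.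
  by apply: (@le_trans _ _ lam); [lra|rewrite ler_peMr; lra].
have [H [H0 H1 H2]] : exists H : nat, [/\ (0 < H)%N, H%:R <= th * lam ^+ 2
    & th * lam ^+ 2 <= 2 * H%:R] by apply: block_count; lra.
have mn : (3 * (H * N + H * N) <= n)%N.
  rewrite -(ler_nat R) natrM natrD !natrM.
  apply: (@le_trans _ _ (th * (6 * N%:R * K ^+ 2) * n%:R)); last by rewrite ler_piMl.
  have -> : th * (6 * N%:R * K ^+ 2) * n%:R = 6 * N%:R * (th * (K ^+ 2 * n%:R)) by ring.
  have -> : 3 * (H%:R * N%:R + H%:R * N%:R) = 6 * N%:R * H%:R :> R by ring.
  by rewrite ler_wpM2l ?mulr_ge0// (le_trans H1)// ler_pM2l.
have [n1 [n3 [nE hn1 hn3 n13]]] := split_time n6 mn.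
have funnel k : (n <= 4 * k.+1)%N -> lam ^+ 2 / 4 <= eta ^+ 2 * lam ^+ 2 + kap * k.+1%:R.
  move=> nk; have nk' : n%:R <= 4 * k.+1%:R :> R by rewrite -natrM ler_nat.
  have h1 := mulr_ge0 (sqr_ge0 eta) (ltW lsq0).
  have h2 := ler_wpM2l (sqr_ge0 K) nk'.
  clear - lsq0 lam2 h1 h2; rewrite /kap; lra.
have wF' j z : (j <= n1.+1 + (H * N + H * N + n3.+1))%N -> win p x0 lam j z -> z \in F.
  by rewrite -nE; exact: wF.
have b1 : cb <= eps * (2 * H%:R).
  have : cb / eps <= 2 * H%:R by clear - e40 thl H2; lra.
  by rewrite ler_pdivrMr// [leRHS]mulrC.
have b2 : 4 <= eps ^+ 2 * (2 * H%:R).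
  have : 4 / eps ^+ 2 <= 2 * H%:R by clear - cb0 thl H2; lra.
  by rewrite ler_pdivrMr ?exprn_gt0// [leRHS]mulrC.
have thlam : th * lam ^+ 2 <= 1 / 2 * lam ^+ 2 by rewrite ler_pM2r.
have b3 : 2 * H%:R <= lam ^+ 2 by clear - H1 thlam; lra.
have b4 : H%:R * (2 + 4 * N%:R * sg2) <= sc * lam ^+ 2.
  have NV : 0 <= 2 + 4 * N%:R * sg2.
    by rewrite addr_ge0// mulr_ge0 ?mulr_ge0// ltW.
  apply: le_trans (ler_wpM2r NV H1) _.
  by rewrite mulrAC ler_pM2r.
have b5 : 2 * (eta * lam) ^+ 2 <= H%:R.
  have -> : 2 * (eta * lam) ^+ 2 = th / 2 * (th * lam ^+ 2) by rewrite /eta; field.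
  have : th * (th * lam ^+ 2) <= 1 / 2 * (th * lam ^+ 2).
    by rewrite ler_pM2r// mulr_gt0.
  have : 0 < th * lam ^+ 2 by rewrite mulr_gt0.
  clear - H2; lra.
have wt' : win p x0 lam (n1.+1 + (H * N + H * N + n3.+1)) t by rewrite -nE.
have := bridge_lower sg0 s00 B0 eta0 eta2 kap0 s0sg reg lamL eps0 N0 split_block
  uF wF' H0 b1 b2 b3 b4 b5 (funnel _ hn1) (funnel _ hn3) wx wt'.
rewrite -nE; apply: le_trans.
rewrite -/lo -/A -/c.
have expq := contraction_pow cc0 lam0 (let: And5 _ _ _ _ h := lamL in h) n13.
move: expq wx wt; set q := 1 - c / lam ^+ 2; set e := expR _ => expq.
set du := `|cpos p x0 0 0|; set dv := `|cpos p x0 n t| => wx wt.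
have sqH : Num.sqrt H%:R <= lam.
  rewrite -(@ler_pXn2r _ 2)// ?nnegrE ?sqrtr_ge0 ?(ltW lam0)// sqr_sqrtr//.
  by have := ler0n R H; clear - b3; lra.
have sq0 : 0 < Num.sqrt H%:R :> R by rewrite sqrtr_gt0 ltr0n.
have lo4 : lo / (4 * lam) <= lo / (4 * Num.sqrt H%:R).
  by rewrite ler_pM2l// lef_pV2 ?posrE ?mulr_gt0// ler_pM2l.
pose W := (start_gain s0 B / (1 + A)) ^+ 2 * (lam / 2 - du + 1) * (lam / 2 - dv + 1) / lam ^+ 2.
have W0 : 0 <= W.
  apply: divr_ge0; last exact: ltW.
  apply: mulr_ge0; last by clear - wt; lra.
  by apply: mulr_ge0; [exact: sqr_ge0|clear - wx; lra].
have A10 : 1 + A != 0 by rewrite gt_eqF//; clear - A0; lra.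
have -> : lo / 4 * (start_gain s0 B / (1 + A)) ^+ 2 * (lam / 2 - du + 1) * (lam / 2 - dv + 1)
    / lam ^+ 3 * e = lo / (4 * lam) * (W * e) by rewrite /W; field; apply/andP.
have -> : lo / (4 * Num.sqrt H%:R) * (q ^+ n1 * (start_gain s0 B * (lam / 2 - du + 1) / lam) / (1 + A)) *
    (q ^+ n3 * (start_gain s0 B * (lam / 2 - dv + 1) / lam) / (1 + A))
    = lo / (4 * Num.sqrt H%:R) * (W * (q ^+ n1 * q ^+ n3)).
  by rewrite /W; field; rewrite lamN A10 /= gt_eqF.
apply: ler_pM => //.
- by rewrite divr_ge0 ?(ltW lo0)// mulr_ge0// ltW.
- by rewrite mulr_ge0// expR_ge0.
- by rewrite ler_wpM2l.
Qed.

End uniform_bound.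

Theorem lemma7p1 (R : realType) (c0 delta0 : R) (hc0 : 0 < c0)
    (hdelta0 : 0 < delta0) (a : int -> R)
    (ha01 : forall i : int, 0 <= a i <= 1)
    (ha : irreducible_aperiodic_seq a) (K : R) (hK : 0 < K) :
  exists (C c lambda0 : R) (n0 : nat),
    [/\ 0 < C, 0 < c, 0 <= lambda0 &
      forall (n : nat), (n0 <= n)%N ->
      forall (d : measure_display) (T : measurableType d)
        (P : probability T R) (X : 'I_n -> {RV P >-> int}),
      independent_RVs X ->
      (forall i : 'I_n, Mclass a delta0 c0 (distribution P (X i))) ->
      forall lambda : R, lambda0 <= lambda -> lambda <= K * Num.sqrt n%:R ->
      forall u v : R, 0 <= u <= lambda -> 0 <= v <= lambda ->
      (0 < P [set w | Sbar X u n w = v])%E ->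
      ((C * (Num.min u (lambda - u) + 1) * (Num.min v (lambda - v) + 1)
          / lambda ^+ 3 * expR (- (c * n%:R / lambda ^+ 2)))%:E
        <= P [set w | [/\ (0 <= Sbar_min X u w)%R, (Sbar_max X u w <= lambda)%R
                        & Sbar X u n w = v]])%E].
Proof.
have M0 : 0 < 8 * c0 / delta0 ^+ 2 by rewrite divr_gt0 ?mulr_gt0 ?exprn_gt0.
have [C [c [l0 [C0 cc0 l04 hbridge]]]] := bridge_uniform K ha01 ha M0.
exists C, c, l0, 6%N; split => //; first by lra.
move=> n n6 d T P X indep hM lam lamlam0 lamK u v u01 v01 hv.
have n0 : (0 < n)%N by exact: leq_trans n6.
have lam0 : 0 <= lam by lra.
have lam2 : lam ^+ 2 <= K ^+ 2 * n%:R.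
  rewrite -[X in _ * X](sqr_sqrtr (ler0n R n)) -exprMn ler_pXn2r// ?nnegrE//.
  by rewrite mulr_ge0 ?sqrtr_ge0// ltW.
have [lw hlw] := choice (fun i => Mclass_law hdelta0 (hM i)).
pose p (i : nat) : law R := lw (insubd (Ordinal n0) i).
have pX (i : 'I_n) : law_prob (p i) = distribution P (X i).
  by rewrite /p valKd; case: (hlw i).
have pa i k : a k <= mass (p i) k by rewrite /p; case: (hlw (insubd (Ordinal n0) i)).
have pM i : E (p i) (fun k => k%:~R ^+ 2) <= 8 * c0 / delta0 ^+ 2.
  by rewrite /p; case: (hlw (insubd (Ordinal n0) i)).
pose x0 := u - lam / 2.
have [t vE] : exists t : int, v = u + t%:~R - mean_sum p 0 n.
  have [w hw] : exists w, Sbar X u n w = v.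
    apply: contrapT => hn; move: hv.
    rewrite (_ : [set w | _] = set0) ?measure0 ?ltxx//.
    by apply/seteqP; split => // w hw; apply: hn; exists w.
  by exists (partial X 0 n w); rewrite -hw (Sbar_partial pX).
rewrite (walk_event pX n0 (erefl x0) vE).
have [F uF wF] := window_finite p x0 lam n.
apply: le_trans (run_le_prob indep pX t uF _); last first.
  by move=> j z /andP[_ jn]; exact: wF.
have x0E : cpos p x0 0 0 = u - lam / 2.
  by rewrite /cpos /mean_sum big_geq// addr0 subr0.
have xnE : cpos p x0 n t = v - lam / 2 by rewrite /cpos vE /x0; ring.
have inwin x : 0 <= x <= lam -> `|x - lam / 2| <= lam / 2.
  by move=> /andP[h1 h2]; rewrite ler_norml; apply/andP; split; lra.
rewrite lee_fin; have := hbridge p pa pM n lam x0 t n6 lamlam0 lam2.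
by rewrite x0E xnE -!min_dist => h; apply: h; exact: inwin.
Qed.
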